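(* Let $R$ be a finite Frobenius ring, let $n$ be a positive integer, and let $C\leq{}_RR^n$ be a modular (left linear) two-weight code of index $r$ with nonzero homogeneous weights $w_1<w_2$, such that $C_0=\{\mathbf{c}\in C;\ \mathrm{w}_{\mathrm{hom}}(\mathbf{c})=0\}=\{\mathbf{0}\}$. Let $C'$ be the dual of the two-weight code $C$ (which is again a modular two-weight code, with $C'_0=\{\mathbf{0}\}$). Then the graph $\Gamma(C')$ is strongly regular with parameters $(N',K',\lambda',\mu')$ given by $$N'=|C|,\quad K'=\frac{n}{r},\quad \lambda'=\frac{2n-w_1-w_2}{r}+\frac{w_1w_2}{r^2|C|},\quad \mu'=\frac{w_1w_2}{r^2|C|}.$$ Moreover, the graph $\Gamma(C')$ is trivial if and only if $w_1=n$ (i.e., if and only if $\Gamma(C)$ is trivial).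
   Context: Rings are associative with $1$; $R^\times$ is the group of units. A finite ring $R$ is a Frobenius ring if there is a character $\chi\in\mathrm{Hom}_{\mathbb{Z}}(R,\mathbb{C}^\times)$ of $(R,+)$ whose kernel contains no nonzero left (or right) ideal of $R$. The (normalized) homogeneous weight $\mathrm{w}_{\mathrm{hom}}\colon R\to\mathbb{C}$ is $\mathrm{w}_{\mathrm{hom}}(x)=1-\frac{1}{|R^\times|}\sum_{u\in R^\times}\chi(ux)$ (independent of the choice of such $\chi$; its values are real and nonnegative). It is extended to $R^n$ by $\mathrm{w}_{\mathrm{hom}}(\mathbf{x})=\sum_{j=1}^n\mathrm{w}_{\mathrm{hom}}(x_j)$. A left (right) linear code is a left (right) submodule of $R^n$. A two-weight code is a linear code on which $\mathrm{w}_{\mathrm{hom}}$ takes exactly two nonzero values. Modular codes: let $C\leq{}_RR^n$ have no all-zero coordinate (for each $j$ some codeword has nonzero $j$-th entry), and write $C=\{\mathbf{x}\mathbf{G};\mathbf{x}\in R^k\}$ with $\mathbf{G}=(\mathbf{g}_1|\dots|\mathbf{g}_n)\in R^{k\times n}$. For a nonzero cyclic right submodule $\mathbf{g}R$ of $R^k_R$ (a ''point'') let $\alpha_C(\mathbf{g}R)=|\{j;\ \mathbf{g}_jR=\mathbf{g}R\}|$. The code $C$ is modular of index $r\in\mathbb{Q}$ if for every point $\mathbf{g}R$ either $\alpha_C(\mathbf{g}R)=0$ or $\alpha_C(\mathbf{g}R)=r\,|\mathbf{g}R^\times|$. (This does not depend on the choice of $k$ and $\mathbf{G}$.) Modularity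 of right linear codes is defined analogously with left and right interchanged. Dual of a two-weight code: let $b_1$ be the number of codewords of $C$ of weight $w_1$ and let $\mathbf{M}_1\in R^{b_1\times n}$ be a matrix whose rows are these codewords in some order. The dual of $C$ is the right linear code $C'=\{\mathbf{M}_1\mathbf{y};\ \mathbf{y}\in R^n\}\leq R^{b_1}_R$ ($\mathbf{y}$ written as a column) generated by the columns of $\mathbf{M}_1$. Its nonzero weights are denoted $w_1'<w_2'$. The graph of a (left or right linear) two-weight code $E$ with nonzero weights $v_1<v_2$ and $E_0=\{\mathbf{c}\in E;\mathrm{w}_{\mathrm{hom}}(\mathbf{c})=0\}$ (a subgroup of $(E,+)$): $\Gamma(E)$ has as vertices the cosets of $E_0$ in $E$, and $\mathbf{c}+E_0$, $\mathbf{d}+E_0$ are adjacent iff $\mathrm{w}_{\mathrm{hom}}(\mathbf{c}-\mathbf{d})=v_1$ (well defined). A simple graph is strongly regular with parameters $(N,K,\lambda,\mu)$ if it has $N$ vertices, is regular of degree $K$, and any two adjacent (resp. distinct nonadjacent) vertices have exactly $\lambda$ (resp. $\mu$) common neighbours. It is called trivial if it or its complement is a disjoint union of cliques of the same size. *)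

(* Defs.v *)
From HB Require Import structures.
From mathcomp Require Import all_boot all_order all_algebra.

Set Implicit Arguments.
Unset Strict Implicit.
Unset Printing Implicit Defensive.

Import Order.TTheory GRing.Theory Num.Theory.
Local Open Scope ring_scope.

(* R is a finite, not necessarily commutative ring.  Elements of left modules  *)
(* are row vectors, elements of right modules are column vectors, and scalars  *)
(* act on a column v on the right by v *m a%:M.  Complex values are taken in   *)
(* an arbitrary numClosedFieldType K; in its order, x < y means that y - x is  *)
(* real and positive.                                                          *)

Definition left_ideal (R : finUnitRingType) (I : {set R}) : Prop :=
  0 \in I /\ forall a : R, {in I &, forall x y, a * x + y \in I}.

Definition right_ideal (R : finUnitRingType) (I : {set R}) : Prop :=
  0 \in I /\ forall a : R, {in I &, forall x y, x * a + y \in I}.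

Definition additive_character (R : finUnitRingType) (K : numClosedFieldType)
    (chi : R -> K) : Prop :=
  (forall x, chi x != 0) /\ {morph chi : x y / x + y >-> x * y}.

Definition char_ker (R : finUnitRingType) (K : numClosedFieldType)
    (chi : R -> K) : {set R} := [set x | chi x == 1].

(* R is a Frobenius ring iff it has a generating character.  For finite rings  *)
(* the left and the right condition on the kernel are equivalent.              *)
Definition generating_character (R : finUnitRingType) (K : numClosedFieldType)
    (chi : R -> K) : Prop :=
  additive_character chi /\
  ((forall I : {set R}, left_ideal I -> I \subset char_ker chi -> I = [set 0]) \/
   (forall I : {set R}, right_ideal I -> I \subset char_ker chi -> I = [set 0])).

Definition units (R : finUnitRingType) : {set R} :=
  [set u : R | u \is a GRing.unit].

(* This is the homogeneous weight when chi is a generating character; it does  *)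
(* not depend on which one.                                                    *)
Definition whom (R : finUnitRingType) (K : numClosedFieldType) (chi : R -> K)
    (x : R) : K :=
  1 - #|units R|%:R^-1 * \sum_(u in units R) chi (u * x).

(* Used for rows (m = 1) and for columns (n = 1).                              *)
Definition whomv (R : finUnitRingType) (K : numClosedFieldType) (chi : R -> K)
    (m n : nat) (c : 'M[R]_(m, n)) : K :=
  \sum_(i < m) \sum_(j < n) whom chi (c i j).

Definition left_linear_code (R : finUnitRingType) (n : nat)
    (C : {set 'rV[R]_n}) : Prop :=
  0 \in C /\ forall a : R, {in C &, forall x y, a *: x + y \in C}.

Definition right_linear_code (R : finUnitRingType) (n : nat)
    (C : {set 'cV[R]_n}) : Prop :=
  0 \in C /\ forall a : R, {in C &, forall x y, x *m a%:M + y \in C}.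

Definition two_weights (R : finUnitRingType) (K : numClosedFieldType)
    (chi : R -> K) (m n : nat) (E : {set 'M[R]_(m, n)}) (v1 v2 : K) : Prop :=
  [/\ v1 < v2, v1 != 0, v2 != 0 &
      forall v : K, v != 0 ->
        (exists2 c, c \in E & whomv chi c = v) <-> (v = v1 \/ v = v2)].

Definition rspan (R : finUnitRingType) (k : nat) (g : 'cV[R]_k) :
    {set 'cV[R]_k} := [set g *m a%:M | a : R].

Definition lspan (R : finUnitRingType) (k : nat) (g : 'rV[R]_k) :
    {set 'rV[R]_k} := [set a *: g | a : R].

Definition rgens (R : finUnitRingType) (k : nat) (g : 'cV[R]_k) :
    {set 'cV[R]_k} := [set g *m u%:M | u in units R].

Definition lgens (R : finUnitRingType) (k : nat) (g : 'rV[R]_k) :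
    {set 'rV[R]_k} := [set u *: g | u in units R].

(* Modularity does not depend on k and G, whence the existential quantifier.   *)
Definition left_modular (R : finUnitRingType) (n : nat) (C : {set 'rV[R]_n})
    (r : rat) : Prop :=
  (forall j : 'I_n, exists2 c, c \in C & c 0 j != 0) /\
  exists (k : nat) (G : 'M[R]_(k, n)),
    C = [set x *m G | x : 'rV[R]_k] /\
    forall g : 'cV[R]_k, g != 0 ->
      let alpha := #|[set j : 'I_n | rspan (col j G) == rspan g]| in
      alpha = 0%N \/ alpha%:R = r * #|rgens g|%:R.

Definition right_modular (R : finUnitRingType) (n : nat) (C : {set 'cV[R]_n})
    (r : rat) : Prop :=
  (forall i : 'I_n, exists2 c, c \in C & c i 0 != 0) /\
  exists (k : nat) (G : 'M[R]_(n, k)),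
    C = [set G *m y | y : 'cV[R]_k] /\
    forall g : 'rV[R]_k, g != 0 ->
      let alpha := #|[set i : 'I_n | lspan (row i G) == lspan g]| in
      alpha = 0%N \/ alpha%:R = r * #|lgens g|%:R.

Definition zero_weight_words (R : finUnitRingType) (K : numClosedFieldType)
    (chi : R -> K) (m n : nat) (E : {set 'M[R]_(m, n)}) :
    {set 'M[R]_(m, n)} := [set c in E | whomv chi c == 0].

Definition lists_words_of_weight (R : finUnitRingType) (K : numClosedFieldType)
    (chi : R -> K) (n : nat) (C : {set 'rV[R]_n}) (v : K)
    (b : nat) (M : 'M[R]_(b, n)) : Prop :=
  perm_eq [seq row i M | i : 'I_b] (enum [set c in C | whomv chi c == v]).

Definition column_code (R : finUnitRingType) (b n : nat) (M : 'M[R]_(b, n)) :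
    {set 'cV[R]_b} := [set M *m y | y : 'cV[R]_n].

(* Graphs are given by a finite set of vertices V and a relation e, of which   *)
(* only the restriction to V matters.                                          *)
Definition simple_graph (T : finType) (V : {set T}) (e : rel T) : Prop :=
  {in V &, symmetric e} /\ {in V, irreflexive e}.

Definition strongly_regular (T : finType) (V : {set T}) (e : rel T)
    (N d lambda mu : nat) : Prop :=
  [/\ simple_graph V e,
      #|V| = N,
      forall x, x \in V -> #|[set z in V | e x z]| = d,
      forall x y, x \in V -> y \in V -> e x y ->
        #|[set z in V | e x z && e y z]| = lambda &
      forall x y, x \in V -> y \in V -> x != y -> ~~ e x y ->
        #|[set z in V | e x z && e y z]| = mu].

Definition disjoint_equal_cliques (T : finType) (V : {set T}) (e : rel T) :
    Prop :=
  exists (P : {set {set T}}) (s : nat),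
    [/\ partition P V,
        forall B, B \in P -> #|B| = s &
        {in V &, forall x y, e x y = (x != y) && (pblock P x == pblock P y)}].

Definition trivial_graph (T : finType) (V : {set T}) (e : rel T) : Prop :=
  disjoint_equal_cliques V e \/
  disjoint_equal_cliques V (fun x y => (x != y) && ~~ e x y).

Definition code_graph_vertices (R : finUnitRingType) (K : numClosedFieldType)
    (chi : R -> K) (m n : nat) (E : {set 'M[R]_(m, n)}) :
    {set {set 'M[R]_(m, n)}} :=
  [set [set c + d | d in zero_weight_words chi E] | c in E].

(* v is the smaller nonzero weight of E.  For cosets A and B the weight of     *)
(* c - d does not depend on the representatives c of A and d of B.             *)
Definition code_graph_adj (R : finUnitRingType) (K : numClosedFieldType)
    (chi : R -> K) (m n : nat) (v : K) : rel {set 'M[R]_(m, n)} :=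
  fun A B => [exists c in A, exists d in B, whomv chi (c - d) == v].

(* Main.v *)
(* Write C = {xG} and let V = {Gy} be the column module of G.  The pairing      *)
(* (xG, Gy) -> chi(xGy) identifies V with the character group of (C, +).  Let  *)
(* S be the set of all generators of the points met by the columns of G.       *)
(* Modularity says that w(c) = n - r S^(c), where S^ is the Fourier transform  *)
(* of S, so S^ takes just two values t1 > t2 on C \ 0, and S is a partial      *)
(* difference set in V with eigenvalues t_i = (n - w_i) / r.  On the other     *)
(* hand w(M1 y) = b1 - C1^(Gy), where C1 is the set of words of weight w1; as  *)
(* the indicator of C1 on C \ 0 is an affine function of S^, Fourier inversion *)
(* shows that w(M1 y) takes one value for Gy in S and a larger one for the     *)
(* other nonzero Gy.  Hence M1 y -> Gy is an isomorphism from the graph of C'  *)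
(* onto the Cayley graph of (V, S), and C1 is the partial difference set dual  *)
(* to S.  Both graphs have mu <> 0, so each is trivial iff mu equals its       *)
(* degree, which for both of them means t1 = 0.                                *)

Require Import Defs.
From HB Require Import structures.
From mathcomp Require Import all_boot all_order all_algebra.
From mathcomp Require Import ring.

Set Implicit Arguments.
Unset Strict Implicit.
Unset Printing Implicit Defensive.

Import Order.TTheory GRing.Theory Num.Theory.
Local Open Scope ring_scope.

(** The harmonic analysis is done for subsets of two finite abelian groups in character duality
    ([dual_pair]). A symmetric set with two nontrivial eigenvalues satisfies a quadratic equation on
    the transform side; inverted, it becomes [eigen_convolution], from which [cayley_srg] reads off
    the parameters, and [eigen_dual] passes to the dual set.

    Codes enter through three facts. Generators of one cyclic module over a finite ring differ by a
    unit ([rspan_eqP], [lspan_eqP]), so modularity counts whole unit orbits ([modular_sum]).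
    Averaging a generating character over left or over right units gives the same weight
    ([sum_units_chiC]), so weight sums stable under units are character sums ([sum_whom], hence
    [modular_weight] and [dual_code_weight]). Finally, the row code and the column code of a matrix
    are dual groups ([code_dual_pair]).

    By [srg_trivialP], triviality means mu = degree; as degree minus mu is minus the product of the
    two eigenvalues, [degree_eq_mu] and [dual_degree_eq_mu] reduce it to [t1 = 0] for both
    graphs. *)

(** * Finite rings *)

(* Moebius inversion on the subset lattice, in the form of an induction. *)
Lemma card_fiber_eq (T I : finType) (L : T -> {set I}) (S S' : {set T}) :
    (forall N : {set I}, #|[set x in S | N \subset L x]| =
                         #|[set x in S' | N \subset L x]|) ->
  forall N : {set I}, #|[set x in S | L x == N]| = #|[set x in S' | L x == N]|.
Proof.
(* Induction on the size of the complement of [N]: the fibres over proper supersets of [N] are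
   already known to agree. *)
move=> eqSS' N; have [m] := ubnP #|~: N|; elim: m N => // m IHm N /ltnSE leNm.
have split_card (Q : {set T}) : #|[set x in Q | N \subset L x]| =
    (#|[set x in Q | L x == N]| +
     \sum_(N' : {set I} | N \proper N') #|[set x in Q | L x == N']|)%N.
  rewrite -sum1_card (partition_big L (fun N' : {set I} => N \subset N')) /=; last first.
    by move=> x; rewrite inE => /andP[].
  rewrite (bigD1 N) //=; congr (_ + _)%N.
    rewrite -sum1_card; apply: eq_bigl => x; rewrite !inE.
    by case: eqP => [-> | _]; rewrite ?andbF // subxx !andbT.
  apply: eq_big => [N' | N' /andP[sNN' _]].
    by rewrite properEneq eq_sym andbC.
  rewrite -sum1_card; apply: eq_bigl => x; rewrite !inE.
  by case: eqP => [-> | _]; rewrite ?andbF // sNN' !andbT.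
have := eqSS' N; rewrite !split_card => /eqP.
rewrite (eq_bigr (fun N' => #|[set x in S' | L x == N']|)) ?eqn_add2r => [/eqP //|N' ltNN'].
by apply: IHm; apply: leq_trans leNm; rewrite proper_card // properC.
Qed.

(** Finiteness of the opposite ring lets mirrored statements be obtained by instantiating at
    [R^c]. *)
HB.instance Definition _ (R : finUnitRingType) := Finite.copy R^c R.

(** Right multiplication by [x] is injective, hence surjective on a finite ring, which gives a left
    inverse; cancelling [x] on the right shows that it is also a right inverse. *)
Lemma regular_unitr (R : finUnitRingType) (x : R) :
  (forall y, y * x = 0 -> y = 0) -> x \is a GRing.unit.
Proof.
move=> regx; have inj : injective (fun y => y * x).
  by move=> y z /eqP; rewrite -subr_eq0 -mulrBl => /eqP/regx/eqP; rewrite subr_eq0 => /eqP.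
have [y y1] : exists y, y * x = 1 by exists (invF inj 1); apply: (f_invF inj 1).
apply/unitrP; exists y; split=> //; apply: inj.
by rewrite -mulrA y1 mulr1 mul1r.
Qed.

Lemma regular_unitl (R : finUnitRingType) (x : R) :
  (forall y, x * y = 0 -> y = 0) -> x \is a GRing.unit.
Proof. exact: (@regular_unitr R^c x). Qed.

(* The elements [x] with [act g x = h] and those with [act g x = g] that are
   killed on the left by a given set are cosets of the same group, and the first
   kind exists iff the second does.  Hence equally many of them have a given left
   annihilator; as 1 is of the second kind and has annihilator 0, some [x] of the
   first kind also has annihilator 0. *)
Lemma associated_of_generators (R : finUnitRingType) (V : zmodType)
    (act : V -> R -> V) (g h : V) (a b : R) :
    (forall v x y, act v (x * y) = act (act v x) y) ->
    (forall v x y, act v (x + y) = act v x + act v y) ->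
    (forall v, act v 1 = v) ->
    act g a = h -> act h b = g ->
  exists2 u, u \in units R & act g u = h.
Proof.
move=> actM actD act1 gah hbg.
have act0 v : act v 0 = 0 by apply: (addrI (act v 0)); rewrite -actD !addr0.
have actN v x : act v (- x) = - act v x.
  by apply/eqP; rewrite -addr_eq0 -actD addNr act0.
pose L (x : R) := [set y : R | y * x == 0].
pose S v := [set x : R | act g x == v].
pose Z (N : {set R}) := [set z : R | (act g z == 0) && (N \subset L z)].
have subL (N : {set R}) x : (N \subset L x) = [forall y in N, y * x == 0].
  by apply/subsetP/forall_inP => [sN y /sN | sN y /sN]; rewrite inE.
have coset v (N : {set R}) x0 : x0 \in S v -> N \subset L x0 ->
    #|[set x in S v | N \subset L x]| = #|Z N|.
  rewrite inE !subL => /eqP gx0 /forall_inP Nx0.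
  rewrite -(card_imset (mem (Z N)) (addrI x0)); apply: eq_card => x.
  rewrite !inE; apply/idP/imsetP => [/andP[/eqP gx Nx] | [z zZ ->]].
    exists (x - x0); last by rewrite addrC subrK.
    rewrite inE actD actN gx gx0 subrr eqxx subL; apply/forall_inP => y yN.
    move: Nx; rewrite subL => /forall_inP/(_ y yN)/eqP Nx.
    by rewrite mulrBr Nx (eqP (Nx0 y yN)) subrr.
  move: zZ; rewrite inE subL => /andP[/eqP gz /forall_inP Nz].
  rewrite actD gx0 gz addr0 eqxx subL; apply/forall_inP => y yN.
  by rewrite mulrDr (eqP (Nx0 y yN)) (eqP (Nz y yN)) addr0.
(* Right multiplication by [c] keeps everything that kills [x] on the left; used with [a] and with
   [b], it makes the two existence statements equivalent. *)
have step v w c (N : {set R}) : act v c = w ->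
    [exists x in S v, N \subset L x] -> [exists x in S w, N \subset L x].
  move=> vcw /exists_inP[x]; rewrite inE => /eqP gx Nx; apply/exists_inP.
  exists (x * c); first by rewrite inE actM gx vcw.
  move: Nx; rewrite !subL => /forall_inP Nx; apply/forall_inP => y /Nx/eqP yx.
  by rewrite mulrA yx mul0r.
have none v (N : {set R}) : ~~ [exists x in S v, N \subset L x] ->
    #|[set x in S v | N \subset L x]| = 0%N.
  rewrite negb_exists_in => /forall_inP noN; apply: eq_card0 => x.
  by rewrite !inE; apply/negP => /andP[xS]; apply/negP/noN; rewrite inE.
have eqL : #|[set x in S g | L x == [set 0%R]]| = #|[set x in S h | L x == [set 0%R]]|.
  apply: card_fiber_eq => N; case exg: [exists x in S g, N \subset L x].
    have /exists_inP[y yS yN] := step _ _ _ _ gah exg.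
    by have /exists_inP[x xS xN] := exg; rewrite (coset g N x) // (coset h N y).
  rewrite !none ?exg //; apply: contraFN exg; exact: step hbg.
have: (0 < #|[set x in S h | L x == [set 0%R]]|)%N.
  rewrite -eqL; apply/card_gt0P; exists (1 : R); rewrite !inE act1 eqxx /=.
  by apply/eqP/setP => y; rewrite in_set1 in_set mulr1.
case/card_gt0P => u; rewrite !inE => /andP[/eqP gu /eqP/setP Lu]; exists u => //.
rewrite inE; apply: regular_unitr => y yu.
by have := Lu y; rewrite !inE yu eqxx => /esym/eqP.
Qed.

Lemma mem_units1 (R : finUnitRingType) : 1 \in units R.
Proof. by rewrite inE unitr1. Qed.

Lemma card_units_neq0 (R : finUnitRingType) (K : numClosedFieldType) :
  #|units R|%:R != 0 :> K.
Proof. by rewrite pnatr_eq0 -lt0n; apply/card_gt0P; exists 1; apply: mem_units1. Qed.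

Lemma rspan_id (R : finUnitRingType) (k : nat) (g : 'cV[R]_k) : g \in rspan g.
Proof. by apply/imsetP; exists 1; rewrite ?mulmx1. Qed.

Lemma lspan_id (R : finUnitRingType) (k : nat) (g : 'rV[R]_k) : g \in lspan g.
Proof. by apply/imsetP; exists 1; rewrite ?scale1r. Qed.

Lemma rspan_unit (R : finUnitRingType) (k : nat) (g : 'cV[R]_k) (u : R) :
  u \is a GRing.unit -> rspan (g *m u%:M) = rspan g.
Proof.
move=> Uu; apply/setP => h; apply/imsetP/imsetP => [[a _ ->]|[a _ ->]].
  by exists (u * a); rewrite // scalar_mxM mulmxA.
exists (u^-1 * a); rewrite // -mulmxA -scalar_mxM mulrA divrr // mul1r.
by [].
Qed.

Lemma lspan_unit (R : finUnitRingType) (k : nat) (g : 'rV[R]_k) (u : R) :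
  u \is a GRing.unit -> lspan (u *: g) = lspan g.
Proof.
move=> Uu; apply/setP => h; apply/imsetP/imsetP => [[a _ ->]|[a _ ->]].
  by exists (a * u); rewrite // scalerA.
by exists (a * u^-1); rewrite // scalerA mulrVK.
Qed.

(** Identifies the generators of a point with a single unit orbit, which is what lets the count in
    the definition of modularity be compared with [rgens]. *)
Lemma rspan_eqP (R : finUnitRingType) (k : nat) (g h : 'cV[R]_k) :
  (rspan h == rspan g) = (h \in rgens g).
Proof.
apply/eqP/imsetP => [eqhg | [u]]; last by rewrite inE => Uu ->; apply: rspan_unit.
have /imsetP[a _ ha] : h \in rspan g by rewrite -eqhg rspan_id.
have /imsetP[b _ gb] : g \in rspan h by rewrite eqhg rspan_id.
suff [u Uu gu] : exists2 u, u \in units R & g *m u%:M = h by exists u.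
apply: (@associated_of_generators R _ (fun (v : 'cV[R]_k) x => v *m x%:M) g h a b) => //.
- by move=> v x y; rewrite scalar_mxM mulmxA.
- by move=> v x y; rewrite raddfD mulmxDr.
by move=> v; rewrite mulmx1.
Qed.

Lemma lspan_eqP (R : finUnitRingType) (k : nat) (g h : 'rV[R]_k) :
  (lspan h == lspan g) = (h \in lgens g).
Proof.
apply/eqP/imsetP => [eqhg | [u]]; last by rewrite inE => Uu ->; apply: lspan_unit.
have /imsetP[a _ ha] : h \in lspan g by rewrite -eqhg lspan_id.
have /imsetP[b _ gb] : g \in lspan h by rewrite eqhg lspan_id.
suff [u Uu gu] : exists2 u, u \in units R & u *: g = h by exists u.
(* The left action of [R] is a right action of the opposite ring. *)
apply: (@associated_of_generators R^c _ (fun (v : 'rV[R]_k) (x : R) => x *: v) g h a b) => //.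
- by move=> v x y; rewrite scalerA.
- by move=> v x y; rewrite scalerDl.
by move=> v; rewrite scale1r.
Qed.
(** * Strongly regular graphs *)

Lemma srg_transfer (T T' : finType) (V : {set T}) (e : rel T) (e' : rel T')
    (f : T -> T') (N d l m : nat) :
    {in V &, injective f} -> {in V &, forall x y, e' (f x) (f y) = e x y} ->
  strongly_regular V e N d l m -> strongly_regular (f @: V) e' N d l m.
Proof.
move=> injf ef [[syme irre] cardV degV lamV muV].
have cardf (P : pred T') (Q : pred T) : {in V, forall z, P (f z) = Q z} ->
    #|[set z in f @: V | P z]| = #|[set z in V | Q z]|.
  move=> PQ; rewrite -(@card_in_imset _ _ f (mem [set z in V | Q z])).
    apply: eq_card => z'; apply/idP/imsetP.
      rewrite inE => /andP[/imsetP[z Vz ->]]; rewrite PQ // => Qz.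
      by exists z; rewrite // !inE Vz.
    by case=> z; rewrite !inE => /andP[Vz Qz] ->; rewrite imset_f // PQ.
  by move=> x y; rewrite !inE => /andP[Vx _] /andP[Vy _]; apply: injf.
split.
- split; first by move=> _ _ /imsetP[x Vx ->] /imsetP[y Vy ->]; rewrite !ef // syme.
  by move=> _ /imsetP[x Vx ->]; rewrite ef // irre.
- by rewrite card_in_imset.
- move=> _ /imsetP[x Vx ->]; rewrite -(degV x Vx).
  by apply: cardf => z Vz; rewrite ef.
- move=> _ _ /imsetP[x Vx ->] /imsetP[y Vy ->]; rewrite ef // => exy.
  by rewrite -(lamV x y) //; apply: cardf => z Vz; rewrite !ef.
move=> _ _ /imsetP[x Vx ->] /imsetP[y Vy ->]; rewrite ef // => nxy exy.
rewrite -(muV x y) //; first by apply: cardf => z Vz; rewrite !ef.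
by apply: contraNneq nxy => ->.
Qed.

(** Nonadjacent vertices share all [d] neighbours, so they have the same neighbourhood and
    nonadjacency is an equivalence; each class is the complement of a neighbourhood, of size
    [N - d]. *)
Lemma srg_complete_multipartite (T : finType) (V : {set T}) (e : rel T)
    (N d l : nat) :
    strongly_regular V e N d l d ->
  disjoint_equal_cliques V (fun x y => (x != y) && ~~ e x y).
Proof.
move=> [[syme irre] cardV degV _ muV].
pose nbr x := [set z in V | e x z].
have eq_nbr : {in V &, forall x y, ~~ e x y -> nbr x = nbr y}.
  move=> x y Vx Vy nexy; have [-> // | nxy] := eqVneq x y.
  have nbrI : nbr x :&: nbr y = [set z in V | e x z && e y z].
    by apply/setP => z; rewrite !inE andbACA andbb.
  have nbr_le u v : u \in V -> v \in V -> #|nbr u :&: nbr v| = d -> nbr u \subset nbr v.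
    move=> Vu Vv card_uv; have /eqP <- : nbr u :&: nbr v == nbr u; last by rewrite subsetIr.
    by rewrite eqEcard subsetIl card_uv degV /=.
  have cardI : #|nbr x :&: nbr y| = d by rewrite nbrI muV.
  by apply/eqP; rewrite eqEsubset !nbr_le // setIC.
pose r x y := ~~ e x y.
have eqr : {in V & &, equivalence_rel r}.
  move=> x y z Vx Vy Vz; split; first by rewrite /r irre.
  move=> rxy; have /setP/(_ z) := eq_nbr x y Vx Vy rxy.
  by rewrite /r !inE Vz /= => ->.
have partV := equivalence_partitionP eqr.
have mem_pb := pblock_equivalence_partition eqr.
exists (equivalence_partition r V), (N - d)%N; split=> //.
  move=> _ /imsetP[x Vx ->]; rewrite -cardV -(degV x Vx).
  have sub_nbr : nbr x \subset V by apply/subsetP => z; rewrite inE => /andP[].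
  rewrite -(cardsDS sub_nbr); congr #|pred_of_set _|; apply/setP => z.
  by rewrite !inE /r; case: (z \in V); rewrite ?andbF ?andbT.
move=> x y Vx Vy; congr (_ && _); rewrite -[LHS](mem_pb x y) //.
have /and3P[/eqP covV tiV _] := partV.
by rewrite eq_pblock // covV.
Qed.

(** A union of cliques gives [x] and [y] no common neighbour, against [m != 0]. If the complement is
    a union of cliques, [x] and [y] lie in one of them and have equal neighbourhoods. The
    nonadjacent pair ties [m] to the graph. *)
Lemma srg_trivialP (T : finType) (V : {set T}) (e : rel T) (N d l m : nat) (x y : T) :
    strongly_regular V e N d l m -> m != 0 ->
    x \in V -> y \in V -> x != y -> ~~ e x y ->
  trivial_graph V e <-> m = d.
Proof.
move=> srg m0 Vx Vy nxy nexy; split=> [|mk]; last first.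
  by right; rewrite mk in srg; apply: srg_complete_multipartite srg.
have [[syme irre] cardV degV _ muV] := srg.
case=> -[P [s [partP _ eP]]].
  case/eqP: m0; rewrite -(muV x y) //; apply: eq_card0 => z; rewrite inE.
  apply/negP => /andP[Vz /andP[exz eyz]]; case/negP: nexy.
  move: exz eyz; rewrite !eP // nxy => /andP[_ /eqP ->] /andP[_ /eqP ->].
  by rewrite eqxx.
have same : pblock P x = pblock P y.
  by have := eP x y Vx Vy; rewrite nxy nexy => /esym/eqP.
rewrite -(muV x y) // -(degV x Vx); apply: eq_card => z; rewrite !inE.
case Vz: (z \in V) => //=; case exz: (e x z) => //=; apply: contraTT exz => neyz.
have [<-|nyz] := eqVneq y z; first exact: nexy.
have := eP y z Vy Vz; rewrite nyz neyz /= => /esym Pyz.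
have [<-|nxz] := eqVneq x z; first by rewrite irre.
by have := eP x z Vx Vz; rewrite same Pyz nxz => /andP[].
Qed.

(** * Fourier transform of partial difference sets *)

(** Everything is relative to [A] and [B] because codes are subsets of ambient modules and their
    pairing is meaningful only there. Nondegeneracy is recorded as the two orthogonality relations,
    a form symmetric in both sides. *)
Record dual_pair (K : numClosedFieldType) (U W : finZmodType)
    (A : {set U}) (B : {set W}) (X : U -> W -> K) : Prop := DualPair {
  dual_pair_zmodl : zmod_closed A;
  dual_pair_zmodr : zmod_closed B;
  dual_pair0l : {in B, forall b, X 0 b = 1};
  dual_pair0r : {in A, forall a, X a 0 = 1};
  dual_pairDl : {in A &, forall a a', {in B, forall b, X (a + a') b = X a b * X a' b}};
  dual_pairDr : {in A, forall a, {in B &, forall b b', X a (b + b') = X a b * X a b'}};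
  dual_pair_orthl : {in B, forall b, \sum_(a in A) X a b = #|A|%:R *+ (b == 0)};
  dual_pair_orthr : {in A, forall a, \sum_(b in B) X a b = #|B|%:R *+ (a == 0)}
}.

Lemma dual_pair_sym (K : numClosedFieldType) (U W : finZmodType)
    (A : {set U}) (B : {set W}) (X : U -> W -> K) :
  dual_pair A B X -> dual_pair B A (fun b a => X a b).
Proof.
case=> zA zB X0 X0' XD XD' orth orth'; split=> //.
  by move=> b b' Bb Bb' a Aa; apply: XD'.
by move=> b Bb a a' Aa Aa'; apply: XD.
Qed.

Lemma dual_pair_card (K : numClosedFieldType) (U W : finZmodType)
    (A : {set U}) (B : {set W}) (X : U -> W -> K) :
  dual_pair A B X -> #|A| = #|B|.
Proof.
case=> -[A0 _] [B0 _] _ _ _ _ orth orth'; apply/eqP; rewrite -(eqr_nat K).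
have <- : \sum_(b in B) \sum_(a in A) X a b = #|A|%:R.
  rewrite (bigD1 0) //= orth // eqxx big1 ?addr0 // => b /andP[Bb /negPf b0].
  by rewrite orth // b0.
rewrite exchange_big (bigD1 0) //= orth' // eqxx big1 ?addr0 // => a /andP[Aa /negPf a0].
by rewrite orth' // a0.
Qed.

Definition fourier (K : numClosedFieldType) (U W : finZmodType)
    (X : U -> W -> K) (S : {set W}) (a : U) : K := \sum_(b in S) X a b.

Definition cayley (W : finZmodType) (S : {set W}) : rel W := fun x y => x - y \in S.

(* [S] is a partial difference set in [B] with nontrivial eigenvalues [t1], [t2]. *)
Record two_eigenvalues (K : numClosedFieldType) (U W : finZmodType)
    (A : {set U}) (B : {set W}) (X : U -> W -> K) (S : {set W}) (t1 t2 : K) : Prop :=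
  TwoEigenvalues {
  eigen_sub : S \subset B;
  eigen_opp : {in S, forall b, - b \in S};
  eigen_n0 : 0 \notin S;
  eigen_val : {in A, forall a, a != 0 -> fourier X S a = t1 \/ fourier X S a = t2}
}.

Section PartialDifferenceSets.

Variables (K : numClosedFieldType) (U W : finZmodType).
Variables (A : {set U}) (B : {set W}) (X : U -> W -> K).
Variable dX : dual_pair A B X.

Let A0 : 0 \in A. Proof. by case: (dual_pair_zmodl dX). Qed.
Let B0 : 0 \in B. Proof. by case: (dual_pair_zmodr dX). Qed.
Let BB : {in B &, forall x y, x - y \in B}.
Proof. by case: (dual_pair_zmodr dX). Qed.
Let BN : {in B, forall x, - x \in B}.
Proof. by move=> x Bx; rewrite -sub0r BB. Qed.

Lemma dual_card_neq0 : #|A|%:R != 0 :> K.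
Proof. by rewrite pnatr_eq0 -lt0n; apply/card_gt0P; exists 0. Qed.

Lemma fourier0 (S : {set W}) : S \subset B -> fourier X S 0 = #|S|%:R.
Proof.
move=> /subsetP sSB; rewrite /fourier (eq_bigr (fun=> 1)) ?sumr_const // => b Sb.
by rewrite (dual_pair0l dX) // sSB.
Qed.

Lemma fourier_inversion (S : {set W}) : S \subset B ->
  {in B, forall b, \sum_(a in A) fourier X S a * X a (- b) = #|A|%:R *+ (b \in S)}.
Proof.
move=> /subsetP sSB b Bb.
have -> : \sum_(a in A) fourier X S a * X a (- b) =
    \sum_(s in S) \sum_(a in A) X a (s - b).
  rewrite exchange_big; apply: eq_bigr => a Aa; rewrite mulr_suml.
  by apply: eq_bigr => s /sSB Bs; rewrite (dual_pairDr dX) ?BN.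
rewrite (eq_bigr (fun s => #|A|%:R *+ (s == b))) => [|s /sSB Bs]; last first.
  by rewrite (dual_pair_orthl dX) ?BB // subr_eq0.
case Sb: (b \in S).
  rewrite (bigD1 b) //= eqxx big1 ?addr0 // => s /andP[_ /negPf ->]; exact: mulr0n.
by apply: big1 => s Ss; case: eqP => // sb; rewrite -sb Ss in Sb.
Qed.

(** The square of the transform of [S] is the transform of the convolution of [S] with itself. *)
Lemma fourier_convolution (S : {set W}) : S \subset B ->
  {in B, forall b, \sum_(a in A) fourier X S a * fourier X S a * X a (- b) =
    #|A|%:R * #|[set s in S | b - s \in S]|%:R}.
Proof.
move=> sSB b Bb; have /subsetP memB := sSB.
have -> : \sum_(a in A) fourier X S a * fourier X S a * X a (- b) =
    \sum_(s in S) \sum_(a in A) fourier X S a * X a (- (b - s)).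
  rewrite exchange_big; apply: eq_bigr => a Aa.
  rewrite {1}/fourier !mulr_suml; apply: eq_bigr => s /memB Bs.
  by rewrite opprB (dual_pairDr dX) ?BN //; ring.
rewrite (eq_bigr (fun s => #|A|%:R *+ (b - s \in S))) => [|s /memB Bs]; last first.
  by rewrite fourier_inversion ?BB.
rewrite -(sum1_card (mem [set s in S | b - s \in S])) natr_sum mulr_sumr.
rewrite [RHS](eq_bigl (fun s => (s \in S) && (b - s \in S))) => [|s]; last by rewrite !inE.
by rewrite big_mkcondr; apply: eq_bigr => s _; case: ifP; rewrite ?mulr1.
Qed.

Variables (S : {set W}) (t1 t2 : K).
Hypothesis eS : two_eigenvalues A B X S t1 t2.

Let sSB : S \subset B. Proof. by case: eS. Qed.
Let k : K := #|S|%:R.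
Let N : K := #|A|%:R.

(** Off 0 the transform is a root of (z - t1)(z - t2); at 0 it is [k]. So its square is (t1 + t2)
    times itself, minus t1 t2, plus (k - t1)(k - t2) at 0 only. Inversion is applied to each
    term. *)
Lemma eigen_convolution : {in B, forall b,
  N * #|[set s in S | b - s \in S]|%:R =
    (t1 + t2) * (N *+ (b \in S)) - t1 * t2 * (N *+ (b == 0)) + (k - t1) * (k - t2)}.
Proof.
move=> b Bb; rewrite -fourier_convolution // -fourier_inversion //.
have -> : N *+ (b == 0) = \sum_(a in A) X a (- b).
  by rewrite (dual_pair_orthl dX) ?BN // oppr_eq0.
have -> : (k - t1) * (k - t2) =
    \sum_(a in A) ((k - t1) * (k - t2)) *+ (a == 0) * X a (- b).
  rewrite (bigD1 0) //= eqxx (dual_pair0l dX) ?BN // mulr1 big1 ?addr0 //.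
  by move=> a /andP[_ /negPf ->]; rewrite mul0r.
rewrite !mulr_sumr -sumrB -big_split; apply: eq_bigr => a Aa /=.
have [->|a0] := eqVneq a 0; first by rewrite fourier0 // mulr1n /k; ring.
by rewrite mulr0n; case: (eigen_val eS Aa a0) => ->; ring.
Qed.

(** The case b = 0 of [eigen_convolution]: since S = -S, every element of [S] is counted. *)
Lemma eigen_degree : k = - (t1 * t2) + (k - t1) * (k - t2) / N.
Proof.
have := eigen_convolution B0; rewrite (negPf (eigen_n0 eS)) eqxx mulr0 sub0r.
have -> : [set s in S | 0 - s \in S] = S.
  apply/setP => s; rewrite inE sub0r; case Ss: (s \in S) => //=.
  by rewrite (eigen_opp eS).
rewrite mulr1n -/k => eqk; have N0 : N != 0 := dual_card_neq0.
by apply: (mulfI N0); rewrite eqk; field.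
Qed.

(** The common neighbours of x and y correspond to the ways of writing x - y as a sum of two
    elements of [S]. The elements [b1] and [b2] supply the natural numbers [l] and [m] as such
    counts. *)
Lemma cayley_srg (b1 b2 : W) : b1 \in S -> b2 \in B -> b2 != 0 -> b2 \notin S ->
  exists l m : nat, [/\ strongly_regular B (cayley S) #|A| #|S| l m,
    l%:R = t1 + t2 + (k - t1) * (k - t2) / N & m%:R = (k - t1) * (k - t2) / N].
Proof.
move=> Sb1 Bb2 b20 nSb2; have Bb1 := subsetP sSB b1 Sb1.
pose conv b := #|[set s in S | b - s \in S]|.
have N0 : N != 0 := dual_card_neq0.
have n0 b : b \in S -> b != 0 by apply: contraTneq => ->; apply: eigen_n0 eS.
have NS s : (- s \in S) = (s \in S).
  by apply/idP/idP => /(eigen_opp eS); rewrite ?opprK.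
have conv_in b : b \in S -> (conv b)%:R = t1 + t2 + (k - t1) * (k - t2) / N.
  move=> Sb; apply: (mulfI N0); rewrite eigen_convolution ?(subsetP sSB) //.
  by rewrite Sb (negPf (n0 b Sb)) mulr1n mulr0n; field.
have conv_out b : b \in B -> b != 0 -> b \notin S ->
    (conv b)%:R = (k - t1) * (k - t2) / N.
  move=> Bb /negPf b0 /negPf nSb; apply: (mulfI N0).
  by rewrite eigen_convolution // nSb b0 !mulr0n; field.
have card_conv x y : x \in B -> y \in B ->
    #|[set z in B | cayley S x z && cayley S y z]| = conv (x - y).
  move=> Bx By; rewrite /conv -(card_imset _ (@subrI _ x)).
  apply: eq_card => s; rewrite /cayley; apply/imsetP/idP => [[z]|].
    rewrite !inE => /and3P[Bz Sxz Syz] ->; rewrite Sxz -NS.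
    by rewrite opprB opprB addrC addrA subrK.
  rewrite inE => /andP[Ss Sxys]; exists (x - s); last by rewrite subKr.
  have Bs := subsetP sSB s Ss; rewrite inE BB //= subKr Ss -NS.
  by rewrite opprB addrAC.
exists (conv b1), (conv b2); split; [split | exact: conv_in | exact: conv_out].
- split=> [x y Bx By | x Bx]; first by rewrite /cayley -NS opprB.
  by rewrite /cayley subrr (negPf (eigen_n0 eS)).
- by rewrite (dual_pair_card dX).
- move=> x Bx; rewrite -(card_imset (mem [set z in B | cayley S x z]) (@subrI _ x)); apply: eq_card => s.
  rewrite /cayley; apply/imsetP/idP => [[z]|Ss]; first by rewrite !inE => /andP[_ ?] ->.
  have Bs := subsetP sSB s Ss.
  by exists (x - s); rewrite ?subKr // inE subKr Ss BB.
- move=> x y Bx By Sxy; rewrite card_conv //.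
  by apply/eqP; rewrite -(eqr_nat K) !conv_in.
move=> x y Bx By nxy nSxy; rewrite card_conv //.
by apply/eqP; rewrite -(eqr_nat K) !conv_out ?BB // subr_eq0.
Qed.

(** On [A] the transform of [S] equals t2, plus (t1 - t2) on the set where it takes the value t1 off
    0, plus (k - t2) at 0; this identity is inverted. *)
Lemma eigen_dual : t1 != t2 -> {in B, forall b,
  N *+ (b \in S) = (k - t2) + t2 * (N *+ (b == 0)) +
   (t1 - t2) * fourier (fun b a => X a b) [set a in A | (a != 0) && (fourier X S a == t1)] b}.
Proof.
move=> t12 b Bb.
have NS s : (- s \in S) = (s \in S).
  by apply/idP/idP => /(eigen_opp eS); rewrite ?opprK.
rewrite -NS -fourier_inversion ?BN // opprK.
have -> : N *+ (b == 0) = \sum_(a in A) X a b by rewrite (dual_pair_orthl dX).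
have {1}-> : k - t2 = \sum_(a in A) (k - t2) *+ (a == 0) * X a b.
  rewrite (bigD1 0) //= eqxx (dual_pair0l dX) // mulr1 big1 ?addr0 //.
  by move=> a /andP[_ /negPf ->]; rewrite mul0r.
have -> : fourier (fun b a => X a b) [set a in A | (a != 0) && (fourier X S a == t1)] b =
    \sum_(a in A) ((a != 0) && (fourier X S a == t1))%:R * X a b.
  rewrite /fourier.
  rewrite (eq_bigl (fun a => (a \in A) && ((a != 0) && (fourier X S a == t1)))).
    by rewrite big_mkcondr; apply: eq_bigr => a _; case: ifP; rewrite ?mul1r ?mul0r.
  by move=> a; rewrite inE.
rewrite !mulr_sumr -!big_split; apply: eq_bigr => a Aa /=.
have [->|a0] /= := eqVneq a 0; first by rewrite fourier0 // mulr1n /k; ring.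
rewrite mulr0n; case: (eigen_val eS Aa a0) => ->; first by rewrite eqxx /= mulr1n; ring.
by rewrite eq_sym (negPf t12) /= mulr0n; ring.
Qed.

(** If [S] were all of [B] without 0, its transform would be -1 at every nonzero point, forcing t1 =
    t2. *)
Lemma eigen_complement (a1 a2 : U) : t1 != t2 ->
    a1 \in A -> a1 != 0 -> fourier X S a1 = t1 ->
    a2 \in A -> a2 != 0 -> fourier X S a2 = t2 ->
  exists2 b, b \in B & (b != 0) && (b \notin S).
Proof.
move=> t12 Aa1 a10 f1 Aa2 a20 f2; apply/exists_inP; apply: contraNT t12.
rewrite negb_exists_in => /forall_inP full.
have fourier_full a : a \in A -> a != 0 -> 1 + fourier X S a = 0.
  move=> Aa /negPf a0; have := dual_pair_orthr dX Aa; rewrite a0 mulr0n => <-.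
  rewrite (bigD1 0) //= (dual_pair0r dX Aa); congr (1 + _); apply: eq_bigl => b.
  apply/idP/andP => [Sb | [Bb b0]]; last by have := full b Bb; rewrite b0 negbK.
  split; first exact: (subsetP sSB).
  by apply: contraTneq Sb => ->; apply: eigen_n0 eS.
by apply/eqP; rewrite -f1 -f2; apply: (@addrI _ 1); rewrite !fourier_full.
Qed.

Hypotheses (lt21 : t2 < t1) (kt1 : k != t1) (kt2 : k != t2).
Variables (b1 b2 : W).
Hypotheses (Sb1 : b1 \in S) (Bb2 : b2 \in B) (b20 : b2 != 0) (nSb2 : b2 \notin S).

Let A1 := [set a in A | (a != 0) && (fourier X S a == t1)].
Let X' := fun (b : W) (a : U) => X a b.
Let l : K := #|A1|%:R.
(** [v1] and [v2] are the values of [l] minus the transform of [A1], on [S] and on the remaining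
    nonzero elements; for codes they are the weights of the dual code. *)
Let v1 := - (N * (t2 + 1)) / (t1 - t2).
Let v2 := - (N * t2) / (t1 - t2).

Let t12 : t1 != t2. Proof. by rewrite gt_eqF. Qed.
Let d0 : t1 - t2 != 0. Proof. by rewrite subr_eq0. Qed.
Let N0 : N != 0. Proof. exact: dual_card_neq0. Qed.
Let k0 : 0 < k. Proof. by rewrite ltr0n; apply/card_gt0P; exists b1. Qed.
Let fourierA1_0 : fourier X' A1 0 = l.
Proof.
rewrite /fourier (eq_bigr (fun=> 1)) ?sumr_const // => a; rewrite inE => /andP[Aa _].
exact: (dual_pair0r dX).
Qed.

Lemma eigen_trace : k - t2 + t2 * N + (t1 - t2) * l = 0.
Proof.
have := eigen_dual t12 B0; rewrite (negPf (eigen_n0 eS)) eqxx mulr0n mulr1n => ->.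
by rewrite -/A1 -/X' fourierA1_0.
Qed.

Let dl : (t1 - t2) * l = - (k - t2 + t2 * N).
Proof. by apply/eqP; rewrite -addr_eq0 addrC eigen_trace. Qed.

(** With t2 = 0, [eigen_trace] would read k + t1 l = 0 with k > 0 and t1 > 0. *)
Lemma eigen2_neq0 : t2 != 0.
Proof.
apply/eqP => t20; have := eigen_trace; rewrite t20 mul0r !subr0 addr0 => /eqP.
have t1l : 0 <= t1 * l by rewrite mulr_ge0 ?ler0n // -t20 ltW.
by rewrite paddr_eq0 ?(ltW k0) // gt_eqF.
Qed.

(** With t2 = -1, [eigen_degree] becomes (k - t1)(N - (k + 1)) = 0, so [S] would be everything but
    0, contradicting [b2]. *)
Lemma eigen2_neqN1 : t2 + 1 != 0.
Proof.
apply/eqP => /eqP; rewrite addr_eq0 => /eqP t2N.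
have : (k - t1) * (N - (k + 1)) == 0.
  have := eigen_degree; rewrite t2N => degE.
  rewrite (_ : _ * _ = N * (k - (- (t1 * -1) + (k - t1) * (k - -1) / N))); last by field.
  by rewrite -degE subrr mulr0.
rewrite mulf_eq0 !subr_eq0 (negPf kt1) natr1 eqr_nat (dual_pair_card dX) => /eqP cardB.
have /proper_card : S \proper B :\ 0.
  apply/properP; split; last by exists b2; rewrite // !inE b20.
  apply/subsetP => b Sb; rewrite !inE (subsetP sSB) // andbT.
  by apply: contraTneq Sb => ->; apply: eigen_n0 eS.
by have := cardsD1 0 B; rewrite B0 cardB add1n => -[<-]; rewrite ltnn.
Qed.

Lemma dual_value1 b : b \in S -> l - fourier X' A1 b = v1.
Proof.
move=> Sb; have b0 : b != 0 by apply: contraTneq Sb => ->; apply: eigen_n0 eS.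
have := eigen_dual t12 (subsetP sSB b Sb); rewrite Sb (negPf b0) mulr0n mulr1n => eqb.
apply: (mulfI d0); rewrite mulrBr /v1 [RHS]mulrC divfK // dl.
have -> : (t1 - t2) * fourier X' A1 b = N - (k - t2) by rewrite eqb; ring.
by ring.
Qed.

Lemma dual_value2 b : b \in B -> b != 0 -> b \notin S -> l - fourier X' A1 b = v2.
Proof.
move=> Bb b0 nSb.
have := eigen_dual t12 Bb; rewrite (negPf nSb) (negPf b0) !mulr0n => eqb.
apply: (mulfI d0); rewrite mulrBr /v2 [RHS]mulrC divfK // dl.
have -> : (t1 - t2) * fourier X' A1 b = - (k - t2) by rewrite -[RHS]addr0 eqb; ring.
by ring.
Qed.

Lemma dual_value1_neq0 : v1 != 0.
Proof. by rewrite mulf_neq0 ?invr_eq0 // oppr_eq0 mulf_neq0 // eigen2_neqN1. Qed.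

Lemma dual_value2_neq0 : v2 != 0.
Proof. by rewrite mulf_neq0 ?invr_eq0 // oppr_eq0 mulf_neq0 // eigen2_neq0. Qed.

Lemma dual_value_lt : v1 < v2.
Proof.
rewrite -subr_gt0 (_ : v2 - v1 = N / (t1 - t2)); last by rewrite /v1 /v2; field.
by rewrite divr_gt0 ?subr_gt0 // lt_neqAle eq_sym N0 ler0n.
Qed.

Lemma dual_two_eigenvalues : two_eigenvalues B A X' A1 (l - v1) (l - v2).
Proof.
have [_ AB] := dual_pair_zmodl dX.
have AN a : a \in A -> - a \in A by move=> Aa; rewrite -sub0r AB.
have X_opp a b : a \in A -> b \in B -> X (- a) b = X a (- b).
  move=> Aa Bb; have X1 : X a b * X (- a) b = 1.
    by rewrite -(dual_pairDl dX) ?AN // subrr (dual_pair0l dX).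
  apply: (mulfI (_ : X a b != 0)); last first.
    by rewrite X1 -(dual_pairDr dX) ?BN // subrr (dual_pair0r dX).
  by apply: contra_eq_neq X1 => ->; rewrite mul0r eq_sym oner_neq0.
split=> [|a|| b Bb b0].
- by apply/subsetP => a; rewrite inE => /andP[].
(* Since S = -S, the transform of [S] takes the same value at a and -a. *)
- rewrite !inE oppr_eq0 => /and3P[Aa -> /eqP <-]; rewrite AN //=; apply/eqP.
  rewrite /fourier (reindex_inj oppr_inj) /=; apply: eq_big => [b | b Sb].
    by apply/idP/idP => /(eigen_opp eS); rewrite ?opprK.
  by rewrite X_opp ?opprK ?(subsetP sSB) //; move: Sb => /(eigen_opp eS); rewrite opprK.
- by rewrite !inE eqxx andbF.
have [Sb | nSb] := boolP (b \in S).
  by left; rewrite -(dual_value1 Sb); ring.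
by right; rewrite -(dual_value2 Bb b0 nSb); ring.
Qed.

(** By [eigen_degree], degree minus mu is -(t1 t2), and t2 is nonzero. *)
Lemma degree_eq_mu : (k - t1) * (k - t2) / N = k <-> t1 = 0.
Proof.
have degE := eigen_degree; split=> [muk | t10]; last by rewrite [RHS]degE t10; ring.
have /eqP : t1 * t2 = 0.
  by apply: oppr_inj; apply: (addIr k); rewrite -{1}muk -degE oppr0 add0r.
by rewrite mulf_eq0 (negPf eigen2_neq0) orbF => /eqP.
Qed.

Lemma dual_degree_eq_mu : v1 * v2 / N = l <-> t1 = 0.
Proof.
(* By [eigen_dual], [e] is (t1 - t2) times the transform of [A1] on [S], that is, a multiple of the
   dual eigenvalue [l - v1]. Then [t1e] shows that it vanishes exactly with t1, and [eE] that mu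
   minus degree is the product of the dual eigenvalues. *)
pose e := N - (k - t2).
have deg0 : k - (- (t1 * t2) + (k - t1) * (k - t2) / N) = 0.
  by rewrite -eigen_degree subrr.
have t1e : N * (t1 * (t2 + 1)) + (k - t1) * e = 0.
  by rewrite -(mulr0 N) -deg0 /e; field.
have eE : (t1 - t2) ^+ 2 * (v1 * v2 / N - l) = - ((k - t2) * e).
  have lE : l = - (k - t2 + t2 * N) / (t1 - t2).
    by apply: (mulfI d0); rewrite [RHS]mulrC divfK // dl.
  rewrite -[RHS]addr0 -(mulr0 N) -deg0 /e lE /v1 /v2; field.
  by rewrite N0.
have -> : v1 * v2 / N = l <-> e = 0.
  split=> [vl | e0].
    apply/eqP; move/eqP: eE; rewrite vl subrr mulr0 eq_sym oppr_eq0 mulf_eq0.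
    by rewrite subr_eq0 (negPf kt2).
  apply/eqP; rewrite -subr_eq0; move/eqP: eE; rewrite e0 mulr0 oppr0 mulf_eq0.
  by rewrite expf_eq0 (negPf d0).
split=> [e0 | t10]; apply/eqP; move/eqP: t1e.
  by rewrite e0 mulr0 addr0 mulf_eq0 (negPf N0) mulf_eq0 (negPf eigen2_neqN1) orbF.
by rewrite t10 mul0r mulr0 add0r mulf_eq0 subr0 (gt_eqF k0).
Qed.

End PartialDifferenceSets.

(** * Generating characters and the homogeneous weight *)

(** Translating by [d] multiplies the sum by [f d], which is not 1. *)
Lemma sum_character (K : numClosedFieldType) (W : finZmodType) (D : {set W})
    (f : W -> K) (d : W) :
    zmod_closed D -> {in D &, {morph f : x y / x + y >-> x * y}} ->
    d \in D -> f d != 1 ->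
  \sum_(x in D) f x = 0.
Proof.
move=> [D0 DB] fD Dd fd1; have DN x : x \in D -> - x \in D.
  by move=> Dx; rewrite -sub0r DB.
have DD x : (d + x \in D) = (x \in D).
  apply/idP/idP => Dx; last by rewrite -[x]opprK DB ?DN.
  by rewrite -(addKr d x) addrC DB.
have eqS : f d * (\sum_(x in D) f x) = \sum_(x in D) f x.
  rewrite mulr_sumr [RHS](reindex_inj (addrI d)) /=.
  by apply: eq_big => [x | x Dx]; rewrite ?DD // fD.
have : (f d - 1) * \sum_(x in D) f x == 0 by rewrite mulrBl eqS mul1r subrr.
by rewrite mulf_eq0 subr_eq0 (negPf fd1) => /eqP.
Qed.

(** Nondegeneracy is asked in the second argument only; [pairing_sym] derives it in the first. *)
Definition pairing (K : numClosedFieldType) (W : finZmodType) (p : W -> W -> K) : Prop :=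
  [/\ forall x y, p x y != 0,
      forall z, {morph p^~ z : x y / x + y >-> x * y},
      forall z, {morph p z : x y / x + y >-> x * y} &
      forall b, (forall a, p a b = 1) -> b = 0].

Lemma additive1 (K : numClosedFieldType) (W : finZmodType) (f : W -> K) :
  (forall x, f x != 0) -> {morph f : x y / x + y >-> x * y} -> f 0 = 1.
Proof.
move=> f0 fD; apply: (mulfI (f0 0)).
by rewrite -fD addr0 mulr1.
Qed.

Lemma sum_additive (K : numClosedFieldType) (W : finZmodType) (f : W -> K) :
    (forall x, f x != 0) -> {morph f : x y / x + y >-> x * y} ->
  \sum_x f x = #|W|%:R *+ [forall x, f x == 1].
Proof.
move=> f0 fD; case: forallP => [f1 | nf1].
  by rewrite (eq_bigr (fun=> 1)) ?sumr_const // => x _; apply/eqP.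
have [x fx1] : exists x, f x != 1.
  by apply/existsP; rewrite -negb_forall; apply/forallP.
have <- : \sum_(y in [set: W]) f y = \sum_y f y by apply: eq_bigl => y; rewrite inE.
have zT : zmod_closed [set: W] by split=> [|y z]; rewrite !inE.
have fDT : {in [set: W] &, {morph f : y z / y + z >-> y * z}} by move=> y z _ _.
by rewrite mulr0n (sum_character zT fDT (in_setT x)).
Qed.

Section Pairing.

Variables (K : numClosedFieldType) (W : finZmodType) (p : W -> W -> K).
Hypothesis pp : pairing p.

Lemma pairing_orth b : \sum_a p a b = #|W|%:R *+ (b == 0).
Proof.
case: pp => p0 pDl pDr inj; rewrite sum_additive //.
congr (_ *+ nat_of_bool _); apply/forallP/eqP => [pb | -> a].
  by apply: inj => a; apply/eqP.
by rewrite (@additive1 _ _ (p a)).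
Qed.

(* The sums over [a] of [p c a] are [0] or [#|W|] and they add up to [#|W|]. *)
Lemma pairing_sym : pairing (fun x y => p y x).
Proof.
have [p0 pDl pDr _] := pp; split=> // b pb.
have cW : #|W|%:R != 0 :> K.
  by rewrite pnatr_eq0 -lt0n; apply/card_gt0P; exists 0.
have row c : \sum_a p c a = #|W|%:R *+ [forall a, p c a == 1].
  exact: sum_additive.
have tot : \sum_c \sum_a p c a = #|W|%:R.
  rewrite exchange_big (bigD1 0) //= pairing_orth eqxx big1 ?addr0 // => a /negPf a0.
  by rewrite pairing_orth a0.
apply/eqP; apply: contraLR cW => b0; rewrite negbK.
have row0 : \sum_a p 0 a = #|W|%:R.
  by rewrite (eq_bigr (fun=> 1)) ?sumr_const // => a _; rewrite (@additive1 _ _ (p^~ a)).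
have rowb : \sum_a p b a = #|W|%:R.
  by rewrite (eq_bigr (fun=> 1)) ?sumr_const.
(* The rows of 0 and [b] would each contribute the full order of [W], and no row is negative, so the
   total would be too large. *)
move: tot; rewrite (bigD1 0) //= row0 (bigD1 b) //= rowb => /eqP.
rewrite -subr_eq0 addrAC subrr add0r paddr_eq0 ?ler0n //; first by case/andP.
by apply: sumr_ge0 => c _; rewrite row mulrn_wge0 ?ler0n.
Qed.

(** The inner products of [f] with the characters [p v] add up to the order of [W], so one of them
    is nonzero, and then the two characters coincide. *)
Lemma pairing_represents (f : W -> K) :
    (forall x, f x != 0) -> {morph f : x y / x + y >-> x * y} ->
  exists v, forall x, f x = p v x.
Proof.
move=> f0 fD; have [p0 pDl pDr _] := pp.
have f1 := additive1 f0 fD; have p1 v := @additive1 _ _ (p v) (p0 v) (pDr v).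
have cW : #|W|%:R != 0 :> K.
  by rewrite pnatr_eq0 -lt0n; apply/card_gt0P; exists 0.
pose g v x := f x * p v (- x).
have gsum v : \sum_x g v x = #|W|%:R *+ [forall x, g v x == 1].
  apply: sum_additive => [x | x y]; first by rewrite mulf_neq0.
  by rewrite /g opprD fD pDr; ring.
have tot : \sum_v \sum_x g v x = #|W|%:R.
  rewrite exchange_big (bigD1 0) //= -mulr_sumr oppr0 pairing_orth eqxx f1 mul1r.
  rewrite big1 ?addr0 // => x /negPf x0.
  by rewrite -mulr_sumr pairing_orth oppr_eq0 x0 mulr0.
have [v gv] : exists v, [forall x, g v x == 1].
  apply/existsP; apply: contraNT cW; rewrite negb_exists => /forallP ng.
  by rewrite -tot big1 // => v _; rewrite gsum (negPf (ng v)).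
exists v => x; have /forallP/(_ x)/eqP gx := gv.
apply: (mulIf (p0 v (- x))); rewrite -pDr subrr p1; exact: gx.
Qed.

End Pairing.

Section HomogeneousWeight.

Variables (R : finUnitRingType) (K : numClosedFieldType) (chi : R -> K).
Hypothesis hchi : generating_character chi.

Lemma chi_neq0 x : chi x != 0. Proof. by case: hchi => -[]. Qed.

Lemma chiD : {morph chi : x y / x + y >-> x * y}.
Proof. by case: hchi => -[]. Qed.

Lemma chi0 : chi 0 = 1. Proof. exact: additive1 chi_neq0 chiD. Qed.

(** An element pairing trivially with everything generates a one-sided ideal inside the kernel.
    [pairing_sym] reconciles the left and right kernel conditions. *)
Lemma generating_pairing : pairing (fun a b => chi (a * b)).
Proof.
have add (p : R -> R -> K) : p = (fun a b => chi (a * b)) \/ p = (fun a b => chi (b * a)) ->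
    (forall b, (forall a, p a b = 1) -> b = 0) -> pairing p.
  case=> -> inj; split=> // [x y | z x y | z x y];
  by rewrite ?chi_neq0 // ?mulrDl ?mulrDr chiD.
case: hchi => _ [genl | genr].
  apply: add; [by left | move=> b kerb].
  have I0 : [set a * b | a : R] = [set 0].
    apply: genl; last by apply/subsetP => _ /imsetP[a _ ->]; rewrite inE kerb.
    split=> [|a _ _ /imsetP[x _ ->] /imsetP[y _ ->]].
      by apply/imsetP; exists 0; rewrite ?mul0r.
    by apply/imsetP; exists (a * x + y); rewrite // mulrDl mulrA.
  apply/set1P; rewrite -I0; apply/imsetP; exists 1; by rewrite ?mul1r.
apply: (@pairing_sym _ _ (fun a b => chi (b * a))).
apply: add; [by right | move=> b kerb].
have I0 : [set b * a | a : R] = [set 0].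
  apply: genr; last by apply/subsetP => _ /imsetP[a _ ->]; rewrite inE kerb.
  split=> [|a _ _ /imsetP[x _ ->] /imsetP[y _ ->]].
    by apply/imsetP; exists 0; rewrite ?mulr0.
  by apply/imsetP; exists (x * a + y); rewrite // mulrDr mulrA.
apply/set1P; rewrite -I0; apply/imsetP; exists 1; by rewrite ?mulr1.
Qed.

Lemma generating_left b : (forall a, chi (a * b) = 1) -> b = 0.
Proof. by case: generating_pairing => _ _ _; apply. Qed.

Lemma generating_right b : (forall a, chi (b * a) = 1) -> b = 0.
Proof. by case: (pairing_sym generating_pairing) => _ _ _; apply. Qed.

(** The character sending x to [chi (x * u)] is represented by some [v] (the Nakayama permutation);
    anything killed by [v] pairs trivially with all of [R], so [v] is regular. *)
Lemma unit_swapl u : u \in units R -> exists2 v, v \in units R &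
  forall x, chi (x * u) = chi (v * x).
Proof.
rewrite inE => Uu.
have [||v swap] := pairing_represents generating_pairing (f := fun x => chi (x * u)).
- by move=> x; apply: chi_neq0.
- by move=> x y; rewrite mulrDl chiD.
exists v => //; rewrite inE; apply: regular_unitl => z vz; apply: generating_right => a.
by rewrite -[a](mulrVK Uu) mulrA swap !mulrA vz !mul0r chi0.
Qed.

Lemma unit_swapr u : u \in units R -> exists2 v, v \in units R &
  forall x, chi (u * x) = chi (x * v).
Proof.
rewrite inE => Uu.
have [||v swap] := pairing_represents (pairing_sym generating_pairing)
  (f := fun x => chi (u * x)).
- by move=> x; apply: chi_neq0.
- by move=> x y; rewrite mulrDr chiD.
exists v => //; rewrite inE; apply: regular_unitr => z zv; apply: generating_left => a.
by rewrite -[a](mulVKr Uu) -mulrA swap -!mulrA zv !mulr0 chi0.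
Qed.

Lemma sum_units_mull (f : R -> K) v : v \in units R ->
  \sum_(u in units R) f (v * u) = \sum_(u in units R) f u.
Proof.
rewrite inE => Uv; rewrite [RHS](reindex_inj (mulrI Uv)).
by apply: eq_bigl => u; rewrite !inE unitrMr.
Qed.

Lemma sum_units_mulr (f : R -> K) v : v \in units R ->
  \sum_(u in units R) f (u * v) = \sum_(u in units R) f u.
Proof.
rewrite inE => Uv; rewrite [RHS](reindex_inj (mulIr Uv)).
by apply: eq_bigl => u; rewrite !inE unitrMl.
Qed.

(* Both sides times the number of units are the sum of [chi (u * x * v)] over
   all pairs of units. *)
Lemma sum_units_chiC x :
  \sum_(u in units R) chi (u * x) = \sum_(u in units R) chi (x * u).
Proof.
apply: (mulfI (card_units_neq0 R K)).
have -> : #|units R|%:R * (\sum_(u in units R) chi (u * x)) =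
    \sum_(v in units R) \sum_(u in units R) chi (u * x * v).
  rewrite mulr_natl -sumr_const; apply: eq_bigr => v Uv.
  have [v' Uv' swap] := unit_swapl Uv.
  under [RHS]eq_bigr do rewrite swap mulrA.
  by rewrite (sum_units_mull (fun u => chi (u * x))).
rewrite exchange_big mulr_natl -sumr_const; apply: eq_bigr => u Uu.
have [u' Uu' swap] := unit_swapr Uu.
under eq_bigr do rewrite -mulrA swap -mulrA.
by rewrite (sum_units_mulr (fun v => chi (x * v))).
Qed.

Lemma whom_right x :
  whom chi x = 1 - #|units R|%:R^-1 * \sum_(u in units R) chi (x * u).
Proof. by rewrite /whom sum_units_chiC. Qed.

Lemma whom_unitl u x : u \in units R -> whom chi (u * x) = whom chi x.
Proof.
move=> Uu; rewrite /whom; under eq_bigr do rewrite mulrA.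
by rewrite (sum_units_mulr (fun v => chi (v * x))).
Qed.

Lemma whom_unitr u x : u \in units R -> whom chi (x * u) = whom chi x.
Proof.
move=> Uu; rewrite !whom_right; under eq_bigr do rewrite -mulrA.
by rewrite (sum_units_mull (fun v => chi (x * v))).
Qed.

(** Each unit permutes the indices, so it contributes the same character sum and the average over
    units collapses. *)
Lemma sum_whom (I : finType) (P : pred I) (f : R -> I -> I) (F : I -> R) :
    {in units R, forall u, injective (f u)} ->
    {in units R, forall u i, P (f u i) = P i} ->
    (forall i, whom chi (F i) = 1 - #|units R|%:R^-1 * \sum_(u in units R) chi (F (f u i))) ->
  \sum_(i | P i) whom chi (F i) = #|[set i | P i]|%:R - \sum_(i | P i) chi (F i).
Proof.
move=> injf Pf whomF; rewrite (eq_bigr _ (fun i _ => whomF i)).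
rewrite sumrB -sum1dep_card natr_sum; congr (_ - _).
rewrite -mulr_sumr exchange_big; apply: (mulfI (card_units_neq0 R K)).
rewrite mulrA divff ?card_units_neq0 // mul1r mulr_natl -sumr_const.
apply: eq_bigr => u Uu.
by rewrite [RHS](reindex_inj (injf u Uu)); apply: eq_bigl => i; rewrite Pf.
Qed.

End HomogeneousWeight.

(** * Codes *)

Lemma whomv_row (R : finUnitRingType) (K : numClosedFieldType) (chi : R -> K)
    (n : nat) (c : 'rV[R]_n) : whomv chi c = \sum_j whom chi (c 0 j).
Proof. by rewrite /whomv big_ord1. Qed.

Lemma whomv_col (R : finUnitRingType) (K : numClosedFieldType) (chi : R -> K)
    (n : nat) (c : 'cV[R]_n) : whomv chi c = \sum_i whom chi (c i 0).
Proof. by rewrite /whomv; apply: eq_bigr => i _; rewrite big_ord1. Qed.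

Lemma whomv_unit (R : finUnitRingType) (K : numClosedFieldType) (chi : R -> K)
    (n : nat) (c : 'rV[R]_n) (u : R) : generating_character chi -> u \in units R ->
  whomv chi (u *: c) = whomv chi c.
Proof.
move=> hchi Uu; rewrite !whomv_row; apply: eq_bigr => j _.
by rewrite mxE whom_unitl.
Qed.

Lemma whomv0 (R : finUnitRingType) (K : numClosedFieldType) (chi : R -> K)
    (m n : nat) : generating_character chi -> whomv chi (0 : 'M[R]_(m, n)) = 0.
Proof.
move=> hchi; rewrite /whomv big1 // => i _; rewrite big1 // => j _.
rewrite mxE /whom; under eq_bigr do rewrite mulr0 (chi0 hchi).
by rewrite sumr_const mulVf ?subrr ?card_units_neq0.
Qed.

Lemma code_graph_verticesE (R : finUnitRingType) (K : numClosedFieldType)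
    (chi : R -> K) (m n : nat) (E : {set 'M[R]_(m, n)}) :
    zero_weight_words chi E = [set 0] ->
  code_graph_vertices chi E = [set [set c] | c in E].
Proof.
move=> E0; apply: eq_imset => c; rewrite E0; apply/setP => d; rewrite inE.
by apply/imsetP/eqP => [[z /set1P -> ->] | ->]; [rewrite addr0 | exists 0; rewrite ?inE ?addr0].
Qed.

Lemma code_graph_adjE (R : finUnitRingType) (K : numClosedFieldType)
    (chi : R -> K) (m n : nat) (v : K) (c d : 'M[R]_(m, n)) :
  code_graph_adj chi v [set c] [set d] = (whomv chi (c - d) == v).
Proof.
apply/exists_inP/idP => [[_ /set1P -> /exists_inP[_ /set1P ->]] // | wcd].
by exists c; rewrite ?inE //; apply/exists_inP; exists d; rewrite ?inE.
Qed.

Lemma sum_rows_of_weight (R : finUnitRingType) (K : numClosedFieldType)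
    (chi : R -> K) (n b : nat) (C : {set 'rV[R]_n}) (v : K) (M : 'M[R]_(b, n))
    (V : nmodType) (f : 'rV[R]_n -> V) : lists_words_of_weight chi C v M ->
  \sum_i f (row i M) = \sum_(c in [set c in C | whomv chi c == v]) f c.
Proof.
by move=> listM; rewrite -(big_image _ _ (fun i => row i M)) (perm_big _ listM) big_enum.
Qed.

Lemma row_of_weight (R : finUnitRingType) (K : numClosedFieldType)
    (chi : R -> K) (n b : nat) (C : {set 'rV[R]_n}) (v : K) (M : 'M[R]_(b, n)) i :
  lists_words_of_weight chi C v M -> row i M \in [set c in C | whomv chi c == v].
Proof.
move=> /perm_mem eqM; rewrite -mem_enum -eqM.
by apply: (map_f (fun i => row i M)); rewrite mem_enum.
Qed.

Lemma column_code_linear (R : finUnitRingType) (b n : nat) (M : 'M[R]_(b, n)) :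
  right_linear_code (column_code M).
Proof.
split=> [|a _ _ /imsetP[y _ ->] /imsetP[z _ ->]]; apply/imsetP.
  by exists 0; rewrite ?mulmx0.
by exists (y *m a%:M + z); rewrite // mulmxDr mulmxA.
Qed.

(** The words of weight [v] form a set stable under units and each is listed once, so the rows meet
    a unit orbit completely or not at all: the index is 1, with [M] itself as generator matrix. *)
Lemma dual_code_modular (R : finUnitRingType) (K : numClosedFieldType)
    (chi : R -> K) (n b : nat) (C : {set 'rV[R]_n}) (v : K) (M : 'M[R]_(b, n)) :
    generating_character chi -> left_linear_code C -> v != 0 ->
    lists_words_of_weight chi C v M ->
  right_modular (column_code M) 1.
Proof.
move=> hchi [C0 CD] v0 listM; split=> [i|].
  have := row_of_weight i listM; rewrite inE => /andP[_ /eqP wi].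
  have [j Mij] : exists j, M i j != 0.
    apply/existsP; apply: contraNT v0; rewrite negb_exists => /forallP Mi0.
    rewrite -wi (_ : row i M = 0) ?whomv0 //; apply/rowP => j; rewrite !mxE.
    by apply/eqP; rewrite -[_ == _]negbK.
  exists (col j M); last by rewrite mxE.
  by apply/imsetP; exists (delta_mx j 0); rewrite // colE.
exists n, M; split=> // g _ alpha.
pose C1 := [set c in C | whomv chi c == v].
have alphaE : alpha = #|C1 :&: lgens g|.
  have cardE (I : finType) (P Q : pred I) :
      #|[set i | P i && Q i]|%:R = \sum_(i | P i) (Q i)%:R :> rat.
    rewrite -sum1dep_card natr_sum big_mkcondr; apply: eq_bigr => i _.
    by case: (Q i).
  apply/eqP; rewrite -(eqr_nat rat) (cardE _ xpredT); apply/eqP.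
  rewrite (sum_rows_of_weight (fun c => (lspan c == lspan g)%:R) listM).
  rewrite -cardE; congr _%:R; apply: eq_card => c.
  by rewrite in_setI -lspan_eqP inE.
have [e0|[c]] := set_0Vmem (C1 :&: lgens g); last first.
  rewrite inE => /andP[C1c gc]; right; rewrite alphaE mul1r; congr _%:R.
  congr #|pred_of_set _|; apply/setIidPr/subsetP => d; rewrite -lspan_eqP => gd.
  have : d \in lgens c by rewrite -lspan_eqP (eqP gd) eq_sym lspan_eqP.
  case/imsetP => u Uu ->; move: C1c; rewrite !inE whomv_unit // => /andP[Cc ->].
  by rewrite -[u *: c]addr0 CD.
by left; rewrite alphaE; apply: eq_card0 => c; rewrite e0 inE.
Qed.

(** * Sums over the columns of a modular generator matrix *)

Definition points (R : finUnitRingType) (k n : nat) (G : 'M[R]_(k, n)) : {set 'cV[R]_k} :=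
  [set h | [exists j, rspan (col j G) == rspan h]].

Lemma points_unit (R : finUnitRingType) (k n : nat) (G : 'M[R]_(k, n)) (h : 'cV[R]_k) u :
  u \in units R -> (h *m u%:M \in points G) = (h \in points G).
Proof. by rewrite !inE => Uu; rewrite rspan_unit. Qed.

Lemma modular_sum (R : finUnitRingType) (K : numClosedFieldType) (k n : nat)
    (G : 'M[R]_(k, n)) (r : rat) (f : 'cV[R]_k -> K) :
    0 \notin points G ->
    (forall g : 'cV[R]_k, g != 0 ->
      let alpha := #|[set j | rspan (col j G) == rspan g]| in
      alpha = 0%N \/ alpha%:R = r * #|rgens g|%:R) ->
    (forall h, {in units R, forall u, f (h *m u%:M) = f h}) ->
  \sum_j f (col j G) = ratr r * \sum_(h in points G) f h.
Proof.
move=> n0 mod_r fu.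
have rgensE (g h : 'cV[R]_k) : rspan g == rspan h -> rgens g = rgens h.
  by move=> /eqP gh; apply/setP => x; rewrite -!rspan_eqP gh.
have f_class (g h : 'cV[R]_k) : rspan g == rspan h -> f g = f h.
  by rewrite rspan_eqP => /imsetP[u Uu ->]; apply: fu.
have card_rgens (g : 'cV[R]_k) : #|rgens g|%:R != 0 :> K.
  rewrite pnatr_eq0 -lt0n; apply/card_gt0P; exists g; by rewrite -rspan_eqP.
(* Double counting: each column spreads its value evenly over the generators of its point, and
   modularity says that a generator collects [r] times its own value. *)
pose F h := f h / #|rgens h|%:R.
have alphaE h : h \in points G ->
    ratr r * f h = \sum_(j | rspan (col j G) == rspan h) F h.
  move=> Ph; have h0 : h != 0 by apply: contraTneq Ph => ->.
  rewrite sumr_const -[RHS]mulr_natr /F.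
  have -> : #|[pred j | rspan (col j G) == rspan h]| = #|[set j | rspan (col j G) == rspan h]|.
    by rewrite cardsE.
  case: (mod_r h h0) => [/eqP | alpha_r].
    rewrite cards_eq0 => /eqP/setP; move: Ph; rewrite inE => /existsP[j jh] /(_ j).
    by rewrite !inE jh.
  have := congr1 (@ratr K) alpha_r; rewrite rmorphM /= !ratr_nat => ->.
  by rewrite [RHS]mulrACA mulVf ?card_rgens // mulr1 mulrC.
rewrite mulr_sumr (eq_bigr _ alphaE) (exchange_big_dep xpredT) //=.
apply: eq_bigr => j _.
rewrite (eq_bigr (fun=> F (col j G))) => [|h /andP[_ jh]]; last first.
  by rewrite /F (f_class _ _ jh) (rgensE _ _ jh).
rewrite sumr_const -[RHS]mulr_natr /F.
have -> : #|[pred h | (h \in points G) && (rspan (col j G) == rspan h)]| = #|rgens (col j G)|.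
  apply: eq_card => h; rewrite -rspan_eqP eq_sym !inE.
  by case jh: (rspan _ == rspan h); rewrite ?andbF // andbT; apply/existsP; exists j.
by rewrite mulrVK ?unitfE ?card_rgens.
Qed.

Lemma mulmx_col_entry (R : finUnitRingType) (m n p : nat) (A : 'M[R]_(m, n))
    (B : 'M[R]_(n, p)) i j : (A *m B) i j = (A *m col j B) i 0.
Proof. by rewrite !mxE; apply: eq_bigr => l _; rewrite !mxE. Qed.

Lemma mulmx_row_entry (R : finUnitRingType) (m n p : nat) (A : 'M[R]_(m, n))
    (B : 'M[R]_(n, p)) i j : (A *m B) i j = (row i A *m B) 0 j.
Proof. by rewrite !mxE; apply: eq_bigr => l _; rewrite !mxE. Qed.

(** * Character duality between the row code and the column code *)

Section CodeDuality.

Variables (R : finUnitRingType) (K : numClosedFieldType) (chi : R -> K).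
Hypothesis hchi : generating_character chi.
Variables (k n : nat) (G : 'M[R]_(k, n)).

Definition row_code : {set 'rV[R]_n} := [set x *m G | x : 'rV[R]_k].

(** A choice of preimage makes the pairing a function of the codeword instead of a representing [x];
    the default 0 is returned only outside the column code. *)
Definition col_section (v : 'cV[R]_k) : 'cV[R]_n := odflt 0 [pick y | G *m y == v].

Lemma col_sectionK v : v \in column_code G -> G *m col_section v = v.
Proof.
case/imsetP => y _ ->; rewrite /col_section; case: pickP => [z /eqP // | /(_ y)].
by rewrite eqxx.
Qed.

(* The pairing of the row code with the column code maps [(x *m G, G *m y)] to
   [chi (x *m G *m y)]. *)
Definition code_pairing (c : 'rV[R]_n) (v : 'cV[R]_k) : K :=
  chi ((c *m col_section v) 0 0).

Lemma code_pairingE (x : 'rV[R]_k) v : v \in column_code G ->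
  code_pairing (x *m G) v = chi ((x *m v) 0 0).
Proof. by move=> Vv; rewrite /code_pairing -mulmxA col_sectionK. Qed.

Lemma code_pairing_col c y : c \in row_code ->
  code_pairing c (G *m y) = chi ((c *m y) 0 0).
Proof. by case/imsetP => x _ ->; rewrite code_pairingE ?imset_f // mulmxA. Qed.

Lemma row_code_zmod : zmod_closed row_code.
Proof.
split=> [|_ _ /imsetP[x _ ->] /imsetP[y _ ->]]; apply/imsetP.
  by exists 0; rewrite ?mul0mx.
by exists (x - y); rewrite ?mulmxBl.
Qed.

Lemma column_code_zmod : zmod_closed (column_code G).
Proof.
split=> [|_ _ /imsetP[x _ ->] /imsetP[y _ ->]]; apply/imsetP.
  by exists 0; rewrite ?mulmx0.
by exists (x - y); rewrite ?mulmxBr.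
Qed.

(** Testing against multiples of unit vectors on either side reduces nondegeneracy to that of [chi]
    in each coordinate; orthogonality is then [sum_character]. *)
Lemma code_dual_pair : dual_pair row_code (column_code G) code_pairing.
Proof.
have [C0 CB] := row_code_zmod; have [V0 VB] := column_code_zmod.
have VD : {in column_code G &, forall v w, v + w \in column_code G}.
  by move=> v w Vv Vw; rewrite -[w]opprK VB // -sub0r VB.
have X0l v : code_pairing 0 v = 1 by rewrite /code_pairing mul0mx mxE (chi0 hchi).
have X0r : {in row_code, forall c, code_pairing c 0 = 1}.
  by move=> _ /imsetP[x _ ->]; rewrite code_pairingE // mulmx0 mxE (chi0 hchi).
have XDl v : {morph code_pairing^~ v : c d / c + d >-> c * d}.
  by move=> c d; rewrite /code_pairing mulmxDl mxE (chiD hchi).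
have XDr : {in row_code, forall c, {in column_code G &, {morph code_pairing c : v w / v + w >-> v * w}}}.
  move=> _ /imsetP[x _ ->] v w Vv Vw.
  by rewrite !code_pairingE ?VD // mulmxDr mxE (chiD hchi).
split=> //.
- by move=> c d _ _ v _; apply: XDl.
- move=> v Vv; have [->|v0] := eqVneq v 0.
    by rewrite (eq_bigr (fun=> 1)) ?sumr_const // => c Cc; rewrite X0r.
  have [c Cc Xcv] : exists2 c, c \in row_code & code_pairing c v != 1.
    apply/exists_inP; apply: contraNT v0; rewrite negb_exists_in => /forall_inP triv.
    apply/eqP/colP => i; rewrite mxE; apply: (generating_left hchi) => a.
    have Cx : (a *: delta_mx 0 i) *m G \in row_code by apply: imset_f.
    have := triv _ Cx; rewrite negbK code_pairingE // -scalemxAl -rowE !mxE.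
    by move/eqP.
  by rewrite (sum_character row_code_zmod _ Cc Xcv) // => c' d' _ _; apply: XDl.
move=> c Cc; have [->|c0] := eqVneq c 0.
  by rewrite (eq_bigr (fun=> 1)) ?sumr_const // => v Vv; rewrite X0l.
have [v Vv Xcv] : exists2 v, v \in column_code G & code_pairing c v != 1.
  apply/exists_inP; apply: contraNT c0; rewrite negb_exists_in => /forall_inP triv.
  apply/eqP/rowP => j; rewrite mxE; apply: (generating_right hchi) => a.
  have Vy : G *m (delta_mx j 0 *m a%:M) \in column_code G by apply: imset_f.
  have := triv _ Vy; rewrite negbK code_pairing_col // mulmxA -colE !mxE.
  by rewrite big_ord1 !mxE eqxx mulr1n => /eqP.
by rewrite (sum_character column_code_zmod (XDr c Cc) Vv Xcv).
Qed.

Hypothesis nz_col : forall j : 'I_n, exists2 c, c \in row_code & c 0 j != 0.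

Lemma points_n0 : 0 \notin points G.
Proof.
rewrite inE; apply/existsP => -[j]; rewrite rspan_eqP => /imsetP[u _] Gj.
have [_ /imsetP[x _ ->]] := nz_col j.
by rewrite mulmx_col_entry Gj mul0mx mulmx0 mxE eqxx.
Qed.

Lemma points_sub : points G \subset column_code G.
Proof.
apply/subsetP => h; rewrite inE => /existsP[j].
rewrite eq_sym rspan_eqP => /imsetP[u _ ->]; apply/imsetP.
by exists (delta_mx j 0 *m u%:M); rewrite // mulmxA -colE.
Qed.

Variable r : rat.
Hypothesis mod_r : forall g : 'cV[R]_k, g != 0 ->
  let alpha := #|[set j | rspan (col j G) == rspan g]| in
  alpha = 0%N \/ alpha%:R = r * #|rgens g|%:R.

Lemma modular_length : n%:R = ratr r * #|points G|%:R :> K.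
Proof.
have := @modular_sum R K k n G r (fun=> 1) points_n0 mod_r (fun _ _ _ => erefl).
by rewrite !sumr_const card_ord.
Qed.

(** [modular_sum] replaces columns by points; right units permute these, so the weight is taken in
    the form [whom_right]. *)
Lemma modular_weight c : c \in row_code ->
  whomv chi c = n%:R - ratr r * fourier code_pairing (points G) c.
Proof.
case/imsetP => x _ ->; rewrite whomv_row.
have mulxu (h : 'cV[R]_k) u : (x *m (h *m u%:M)) 0 0 = (x *m h) 0 0 * u.
  by rewrite mulmxA [LHS]mxE big_ord1 [u%:M 0 0]mxE eqxx mulr1n.
rewrite (eq_bigr _ (fun j _ => congr1 _ (mulmx_col_entry x G 0 j))).
rewrite (@modular_sum R K k n G r (fun h => whom chi ((x *m h) 0 0))) //; first last.
- by move=> h u Uu; rewrite mulxu whom_unitr.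
- exact: points_n0.
rewrite (@sum_whom _ _ _ _ (fun h => h \in points G) (fun u h => h *m u%:M)).
- rewrite mulrBr modular_length; congr (_ * _ - _ * _).
    by congr _%:R; apply: eq_card => h; rewrite inE.
  by apply: eq_bigr => h /(subsetP points_sub) Vh; rewrite code_pairingE.
- move=> u; rewrite inE => Uu; apply: (can_inj (g := fun h => h *m (u^-1)%:M)) => h.
  by rewrite -mulmxA -scalar_mxM divrr // mulmx1.
- by move=> u Uu h; rewrite points_unit.
by move=> h; rewrite (whom_right hchi); under [in RHS]eq_bigr do rewrite mulxu.
Qed.

Variables (b : nat) (v : K) (M : 'M[R]_(b, n)).
Hypothesis listM : lists_words_of_weight chi row_code v M.

Let Cv := [set c in row_code | whomv chi c == v].

Lemma card_words_of_weight : b = #|Cv|.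
Proof. by have /perm_size := listM; rewrite size_map -cardE -[X in _ = X]cardE card_ord. Qed.

(** The rows of [M] run over [Cv], which left units permute, so [sum_whom] applies with the defining
    form of the weight. *)
Lemma dual_code_weight y : whomv chi (M *m y) =
  b%:R - fourier (fun h c => code_pairing c h) Cv (G *m y).
Proof.
rewrite whomv_col.
rewrite (eq_bigr _ (fun i _ => congr1 _ (mulmx_row_entry M y i 0))).
rewrite (sum_rows_of_weight (fun c => whom chi ((c *m y) 0 0)) listM).
have scaleKu u : u \in units R -> cancel (fun c : 'rV[R]_n => u *: c) (fun c => u^-1 *: c).
  by rewrite inE => Uu c; rewrite scalerA mulVr // scale1r.
rewrite (@sum_whom _ _ _ _ (fun c => c \in Cv) (fun u c => u *: c)).
- rewrite card_words_of_weight; congr (_ - _).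
    by congr _%:R; apply: eq_card => c; rewrite inE.
  by apply: eq_bigr => c; rewrite inE => /andP[Cc _]; rewrite code_pairing_col.
- by move=> u /scaleKu/can_inj.
- move=> u Uu c; rewrite !inE whomv_unit //; congr (_ && _).
  have scale a d : d \in row_code -> a *: d \in row_code.
    by case/imsetP => x _ ->; rewrite scalemxAl; apply: imset_f.
  by apply/idP/idP => [/(scale u^-1)|]; [rewrite scaleKu | apply: scale].
by move=> c; rewrite /whom; under [in RHS]eq_bigr do rewrite -scalemxAl mxE.
Qed.

End CodeDuality.

(** * Transfer to the graphs of the two codes *)

Theorem theorem16 (R : finUnitRingType) (K : numClosedFieldType)
    (chi : R -> K) (hchi : generating_character chi)
    (n : nat) (hn : (0 < n)%N)
    (C : {set 'rV[R]_n}) (hC : left_linear_code C)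
    (r : rat) (hmod : left_modular C r)
    (w1 w2 : K) (hw : two_weights chi C w1 w2)
    (hC0 : zero_weight_words chi C = [set 0])
    (b1 : nat) (M1 : 'M[R]_(b1, n))
    (hM1 : lists_words_of_weight chi C w1 M1) :
  let C' := column_code M1 in
  [/\ right_linear_code C',
      exists r' : rat, right_modular C' r',
      zero_weight_words chi C' = [set 0] &
      exists w1' w2' : K,
        [/\ two_weights chi C' w1' w2',
            exists N' K' lambda' mu' : nat,
              [/\ strongly_regular (code_graph_vertices chi C')
                    (code_graph_adj chi w1') N' K' lambda' mu',
                  N' = #|C|,
                  (K'%:R : K) = n%:R / ratr r,
                  (lambda'%:R : K) =
                    (2%:R * n%:R - w1 - w2) / ratr r
                    + w1 * w2 / (ratr r ^+ 2 * #|C|%:R) &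
                  (mu'%:R : K) = w1 * w2 / (ratr r ^+ 2 * #|C|%:R)],
            trivial_graph (code_graph_vertices chi C') (code_graph_adj chi w1')
              <-> w1 = n%:R &
            trivial_graph (code_graph_vertices chi C) (code_graph_adj chi w1)
              <-> w1 = n%:R]].
Proof.
move=> C'; case: hmod => nz [k [G [CG mod_r]]].
have {CG} eqC : C = row_code G := CG; subst C.
have dX := code_dual_pair hchi G.
set C := row_code G in hC nz hw hC0 hM1 dX *; set V := column_code G in dX.
set X := code_pairing chi G in dX; pose S := points G; pose q : K := ratr r.
case: (hw) => lt12 w10 w20 weightP.
have sSV : S \subset V := points_sub G.
have nq : n%:R = q * #|S|%:R := modular_length K nz mod_r.
have weightC c : c \in C -> whomv chi c = n%:R - q * fourier X S c :=
  modular_weight hchi nz mod_r (c := c).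
have n_gt0 : 0 < n%:R :> K by rewrite ltr0n.
have S_gt0 : 0 < #|S|%:R :> K.
  rewrite lt_neqAle ler0n andbT eq_sym; apply: contraTneq n_gt0 => S0.
  by rewrite nq S0 mulr0 ltxx.
have q_gt0 : 0 < q by move: n_gt0; rewrite nq pmulr_lgt0.
have q0 : q != 0 by rewrite gt_eqF.
(* Solutions of w_i = n - q t_i, from [modular_weight]; the smaller weight gives the larger
   eigenvalue. *)
pose t1 := (n%:R - w1) / q; pose t2 := (n%:R - w2) / q.
have lt21 : t2 < t1 by rewrite ltr_pM2r ?invr_gt0 // ltrD2l ltrN2.
have t12 : t1 != t2 by rewrite gt_eqF.
have fourierE c : c \in C -> fourier X S c = (n%:R - whomv chi c) / q.
  by move=> /weightC ->; field.
have cardS : #|S|%:R = n%:R / q by rewrite nq; field.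
have kt1E : #|S|%:R - t1 = w1 / q by rewrite cardS /t1; field.
have kt2E : #|S|%:R - t2 = w2 / q by rewrite cardS /t2; field.
have kt1 : #|S|%:R != t1 by rewrite -subr_eq0 kt1E mulf_neq0 ?invr_eq0.
have kt2 : #|S|%:R != t2 by rewrite -subr_eq0 kt2E mulf_neq0 ?invr_eq0.
have whom_n0 c : c \in C -> c != 0 -> whomv chi c != 0.
  move=> Cc; apply: contraNneq => wc0; rewrite -in_set1 -hC0 inE Cc wc0; exact: eqxx.
have eS : two_eigenvalues C V X S t1 t2.
  split=> // [h Sh | | c Cc c0].
  - by rewrite -[h]mulmx1 -mulmxN -raddfN /= points_unit // inE unitrN1.
  - exact: points_n0 nz.
  have wc : whomv chi c = w1 \/ whomv chi c = w2.
    by apply/(weightP _ (whom_n0 c Cc c0)); exists c.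
  by rewrite fourierE //; case: wc => ->; [left | right].
have fourier_t1 c : c \in C -> (fourier X S c == t1) = (whomv chi c == w1).
  move=> Cc; rewrite fourierE // (inj_eq (mulIf _)) ?invr_eq0 //.
  by rewrite (inj_eq (addrI _)) eqr_opp.
pose C1 := [set c in C | (c != 0) && (fourier X S c == t1)].
have C1E : [set c in C | whomv chi c == w1] = C1.
  apply/setP => c; rewrite !inE; case Cc: (c \in C) => //=; rewrite fourier_t1 //.
  rewrite andb_idl // => /eqP wc; apply: contra_eq_neq wc => ->.
  by rewrite whomv0 // eq_sym.
have b1E : b1 = #|C1| by rewrite (card_words_of_weight hM1) C1E.
have [c1 Cc1 wc1] : exists2 c, c \in C & whomv chi c = w1.
  by apply/(weightP w1 w10); left.
have [c2 Cc2 wc2] : exists2 c, c \in C & whomv chi c = w2.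
  by apply/(weightP w2 w20); right.
have whom_neq0 c : whomv chi c != 0 -> c != 0.
  by apply: contraNneq => ->; rewrite whomv0.
have c10 : c1 != 0 by rewrite whom_neq0 // wc1.
have c20 : c2 != 0 by rewrite whom_neq0 // wc2.
have [v2 Vv2 /andP[v20 nSv2]] : exists2 v, v \in V & (v != 0) && (v \notin S).
  apply: (eigen_complement dX eS t12 Cc1 c10 _ Cc2 c20).
    by rewrite fourierE // wc1.
  by rewrite fourierE // wc2.
have [v1 Sv1] : exists v, v \in S by apply/card_gt0P; rewrite -(ltr0n K).
pose N : K := #|C|%:R.
pose w1' := - (N * (t2 + 1)) / (t1 - t2); pose w2' := - (N * t2) / (t1 - t2).
have w1'0 : w1' != 0 := dual_value1_neq0 dX eS lt21 kt1 Vv2 v20 nSv2.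
have w2'0 : w2' != 0 := dual_value2_neq0 dX eS lt21 Sv1.
have lt12' : w1' < w2' := dual_value_lt dX lt21.
have weight1 y : G *m y \in S -> whomv chi (M1 *m y) = w1'.
  move=> Sy; rewrite (dual_code_weight hchi hM1) -/C C1E b1E.
  exact: (dual_value1 dX eS lt21 Sy).
have weight2 y : G *m y != 0 -> G *m y \notin S -> whomv chi (M1 *m y) = w2'.
  move=> y0 nSy; rewrite (dual_code_weight hchi hM1) -/C C1E b1E.
  by apply: (dual_value2 dX eS lt21 _ y0 nSy); apply: imset_f.
(* The rows of [M1] are words xG, so M1 y depends only on Gy; conversely ([kerM]) a nonzero Gy gives
   a nonzero weight, so the correspondence is bijective. *)
have kerG (y : 'cV[R]_n) : G *m y = 0 -> M1 *m y = 0.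
  move=> Gy; apply/colP => i; rewrite mulmx_row_entry.
  have := row_of_weight i hM1; rewrite inE => /andP[/imsetP[x _ ->] _].
  by rewrite -mulmxA Gy mulmx0 !mxE.
have weight0 (y : 'cV[R]_n) : whomv chi (M1 *m y) = 0 -> G *m y = 0.
  move=> wy; apply/eqP; apply: contraT => y0; move: wy.
  have [Sy | nSy] := boolP (G *m y \in S).
    by rewrite weight1 // => /eqP; rewrite (negPf w1'0).
  by rewrite weight2 // => /eqP; rewrite (negPf w2'0).
have weight_adj (y : 'cV[R]_n) : (whomv chi (M1 *m y) == w1') = (G *m y \in S).
  have [y0 | y0] := eqVneq (G *m y) 0.
    rewrite kerG // whomv0 // eq_sym (negPf w1'0) y0.
    by rewrite (negPf (eigen_n0 eS)).
  have [Sy | nSy] := boolP (G *m y \in S); first by rewrite weight1 // eqxx.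
  by rewrite weight2 // gt_eqF.
have kerM (y z : 'cV[R]_n) : M1 *m y = M1 *m z -> G *m y = G *m z.
  move=> /eqP; rewrite -subr_eq0 -mulmxBr => /eqP yz; apply/eqP.
  by rewrite -subr_eq0 -mulmxBr weight0 // yz whomv0.
have C'0 : zero_weight_words chi C' = [set 0].
  apply/setP => c; rewrite !inE; apply/andP/eqP => [[/imsetP[y _ ->] /eqP/weight0/kerG] // | ->].
  by rewrite whomv0 // eqxx; split=> //; apply/imsetP; exists 0; rewrite ?mulmx0.
have w12' : two_weights chi C' w1' w2'.
  split=> // v v0; split=> [[_ /imsetP[y _ ->] wv] | [-> | ->]].
  - have [Sy | nSy] := boolP (G *m y \in S); first by left; rewrite -wv weight1.
    by right; rewrite -wv weight2 //; apply: contraNneq v0 => y0; rewrite -wv kerG // whomv0.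
  - exists (M1 *m col_section G v1); first exact: imset_f.
    by rewrite weight1 // col_sectionK // (subsetP sSV).
  exists (M1 *m col_section G v2); first exact: imset_f.
  by rewrite weight2 // col_sectionK.
have [l [m [srgV lE mE]]] := cayley_srg dX eS Sv1 Vv2 v20 nSv2.
pose f (v : 'cV[R]_k) := [set M1 *m col_section G v].
have injf : {in V &, injective f}.
  by move=> v w Vv Vw /set1_inj/kerM; rewrite !col_sectionK.
have adjf : {in V &, forall v w, code_graph_adj chi w1' (f v) (f w) = cayley S v w}.
  move=> v w Vv Vw; rewrite code_graph_adjE -mulmxBr weight_adj mulmxBr.
  by rewrite !col_sectionK.
have imf : f @: V = code_graph_vertices chi C'.
  rewrite code_graph_verticesE //; apply/setP => A; apply/imsetP/imsetP => -[].
    by move=> v Vv ->; exists (M1 *m col_section G v); rewrite // imset_f.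
  move=> _ /imsetP[y _ ->] ->; exists (G *m y); first exact: imset_f.
  congr [set _]; apply/eqP; rewrite -subr_eq0 -mulmxBr; apply/eqP/kerG.
  by rewrite mulmxBr col_sectionK ?subrr // imset_f.
have srgC' := srg_transfer injf adjf srgV; rewrite imf in srgC'.
have t1_eq0 : t1 = 0 <-> w1 = n%:R.
  split=> [/eqP | w1n]; last by rewrite /t1 w1n subrr mul0r.
  by rewrite mulf_eq0 invr_eq0 (negPf q0) orbF subr_eq0 => /eqP.
have m_neq0 : m != 0%N.
  rewrite -(eqr_nat K) mE kt1E kt2E !mulf_neq0 ?invr_eq0 //.
  exact: (dual_card_neq0 dX).
split; [exact: column_code_linear | by exists 1; apply: dual_code_modular hM1 | by [] |].
exists w1', w2'; split=> //.
- exists #|C|, #|S|, l, m; split=> //.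
    rewrite lE kt1E kt2E /t1 /t2; field.
    by rewrite (dual_card_neq0 dX) q0.
  rewrite mE kt1E kt2E; field.
  by rewrite (dual_card_neq0 dX) q0.
- rewrite -t1_eq0 -(degree_eq_mu dX eS lt21 Sv1).
  have nadj : ~~ code_graph_adj chi w1' (f v2) (f 0).
    by rewrite adjf ?(proj1 (dual_pair_zmodr dX)) // /cayley subr0.
  have V0 : 0 \in V := proj1 (dual_pair_zmodr dX).
  have nf : f v2 != f 0 by apply: contraNneq v20 => /injf ->.
  have imV v : v \in V -> f v \in code_graph_vertices chi C' by move=> Vv; rewrite -imf imset_f.
  rewrite (srg_trivialP srgC' m_neq0 (imV _ Vv2) (imV _ V0) nf nadj) -mE.
  by split=> [-> // | /eqP]; rewrite eqr_nat => /eqP.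
(* For the graph of [C] the two groups are exchanged: it is the Cayley graph of [C1], with
   eigenvalues |C1| - w1' and |C1| - w2', whence mu = w1' w2' / N. *)
rewrite -t1_eq0 -(dual_degree_eq_mu dX eS lt21 kt1 kt2 Sv1 Vv2 v20 nSv2).
have dX' := dual_pair_sym dX; have eC1 := dual_two_eigenvalues dX eS lt21.
have C1c1 : c1 \in C1 by rewrite -C1E inE Cc1 wc1 eqxx.
have nC1c2 : c2 \notin C1 by rewrite -C1E inE Cc2 wc2 gt_eqF.
have [l' [m' [srgC _ mE']]] := cayley_srg dX' eC1 C1c1 Cc2 c20 nC1c2.
have C0 : 0 \in C := proj1 (dual_pair_zmodl dX).
have CB : {in C &, forall c d, c - d \in C} := proj2 (dual_pair_zmodl dX).
have adjC : {in C &, forall c d, code_graph_adj chi w1 [set c] [set d] = cayley C1 c d}.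
  by move=> c d Cc Cd; rewrite code_graph_adjE /cayley -C1E inE CB.
have inj1 : {in C &, injective (fun c : 'rV[R]_n => [set c])}.
  by move=> c d _ _; apply: set1_inj.
have := srg_transfer inj1 adjC srgC; rewrite -(code_graph_verticesE hC0) => srgC1.
have {}mE' : m'%:R = w1' * w2' / N.
  by rewrite mE' -(dual_pair_card dX) !subKr.
have m'0 : m' != 0%N.
  rewrite -(eqr_nat K) mE'; apply: mulf_neq0 (mulf_neq0 w1'0 w2'0) _.
  by rewrite invr_eq0; apply: (dual_card_neq0 dX).
have nadj : ~~ code_graph_adj chi w1 [set c2] [set 0].
  by rewrite adjC // /cayley subr0.
have n12 : [set c2] != [set 0] by apply: contraNneq c20 => /set1_inj ->.
have imC c : c \in C -> [set c] \in code_graph_vertices chi C.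
  by move=> Cc; rewrite code_graph_verticesE // imset_f.
rewrite (srg_trivialP srgC1 m'0 (imC _ Cc2) (imC _ C0) n12 nadj) -/N -/w1' -/w2' -mE'.
by split=> [-> // | /eqP]; rewrite eqr_nat => /eqP.
Qed.
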